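(* Let $P$ be the set of all prime numbers. For all subsets $S,T\subseteq P$, $\mathbb{A}_S\leq_{BSS}\mathbb{A}_T$ if and only if $S\subseteq T$.
   Context: BSS machines over $\mathbb{R}$: $\mathbb{R}^\infty$ is the set of finite tuples of reals. A BSS machine has a program with finitely many real constants (parameters); it can apply $+,-,\times,\div$ to cell contents, copy cells, overwrite a cell with $0$, and branch on whether a cell's content is $=0$, $<0$ or $>0$. An oracle BSS machine with oracle $B\subseteq\mathbb{R}^\infty$ may additionally branch on whether a previously computed tuple lies in $B$. $B\leq_{BSS}A$ means the characteristic function of $B$ is computed by some oracle BSS machine (with real parameters allowed) using oracle $A$. $\mathbb{A}_{=d}$ is the set of real numbers algebraic over $\mathbb{Q}$ of degree exactly $d$ over $\mathbb{Q}$, and for $S\subseteq\omega$, $\mathbb{A}_S=\bigcup_{d\in S}\mathbb{A}_{=d}$. *)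

(* Defs.v *)
From HB Require Import structures.
From mathcomp Require Import all_boot all_order all_algebra.
From mathcomp Require Import boolp classical_sets reals.

Set Implicit Arguments.
Unset Strict Implicit.
Unset Printing Implicit Defensive.

Import Order.TTheory GRing.Theory Num.Theory.
Local Open Scope ring_scope.
Local Open Scope classical_set_scope.

(** * Oracle BSS machines over the reals

    [R^infinity] is [seq R].  The memory is a bi-infinite tape of real cells;
    a cell is named by its (integer) offset from the scanned cell, and the two
    move instructions shift the tape, so that a fixed finite program can reach
    every cell. *)

Definition tape (R : realType) := int -> R.

Variant arith := OpAdd | OpSub | OpMul | OpDiv.

(* Code locations are positions in the program.  All instructions but the two
   branching ones continue at the next position. *)
Variant instr (R : realType) :=
  | Const (dst : int) (c : R)            (* a real parameter of the machine *)
  | Zero (dst : int)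
  | Copy (dst src : int)
  | Arith (o : arith) (dst src1 src2 : int)
  | MoveLeft
  | MoveRight
  | BranchSign (src : int) (lneg lzero lpos : nat)
  | BranchOracle (src : int) (lyes lno : nat).

Arguments Zero {R}.
Arguments Copy {R}.
Arguments Arith {R}.
Arguments MoveLeft {R}.
Arguments MoveRight {R}.
Arguments BranchSign {R}.
Arguments BranchOracle {R}.

Definition program (R : realType) := seq (instr R).

Record config (R : realType) := Config { loc : nat; cells : tape R }.

(* A tuple [x_1, ..., x_n] sits on the tape as its length [n] in cell 0,
   followed by its entries in cells 1, ..., n. *)
Definition encode (R : realType) (x : seq R) : tape R :=
  fun i => match i with
           | Posz 0 => (size x)%:R
           | Posz j.+1 => nth 0 x j
           | Negz _ => 0
           end.

Definition decode (R : realType) (t : tape R) : option (seq R) :=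
  if t 0 \is a Num.nat then Some (mkseq (fun j => t j.+1%:Z) (Num.truncn (t 0)))
  else None.

Definition shift (R : realType) (k : int) (t : tape R) : tape R :=
  fun i => t (k + i).

(* [None]: division by zero is undefined. *)
Definition arith_eval (R : realType) (o : arith) (a b : R) : option R :=
  match o with
  | OpAdd => Some (a + b)
  | OpSub => Some (a - b)
  | OpMul => Some (a * b)
  | OpDiv => if b == 0 then None else Some (a / b)
  end.

(* An undefined operation (division by zero, or an oracle query on cells which
   do not encode a tuple) leaves the configuration unchanged, so that the
   machine runs forever without halting. *)
Definition exec (R : realType) (B : set (seq R)) (ins : instr R) (c : config R) :
    config R :=
  let t := cells c in
  let next t' := Config (loc c).+1 t' in
  match ins with
  | Const i a => next [eta t with i |-> a]
  | Zero i => next [eta t with i |-> 0]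
  | Copy i j => next [eta t with i |-> t j]
  | Arith o i j k =>
      if arith_eval o (t j) (t k) is Some a then next [eta t with i |-> a] else c
  | MoveLeft => next (shift (-1) t)
  | MoveRight => next (shift 1 t)
  | BranchSign i lneg lzero lpos =>
      Config (if t i < 0 then lneg else if t i == 0 then lzero else lpos) t
  | BranchOracle i lyes lno =>
      if decode (shift i t) is Some y
      then Config (if `[< B y >] then lyes else lno) t
      else c
  end.

Definition halted (R : realType) (M : program R) (c : config R) : bool :=
  (size M <= loc c)%N.

Definition step (R : realType) (B : set (seq R)) (M : program R) (c : config R) :
    config R :=
  if onth M (loc c) is Some ins then exec B ins c else c.

Definition init (R : realType) (x : seq R) : config R := Config 0 (encode x).

Definition run (R : realType) (B : set (seq R)) (M : program R) (x : seq R)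
    (n : nat) : config R :=
  iter n (step B M) (init x).

Definition bss_computes (R : realType) (B : set (seq R)) (M : program R)
    (f : seq R -> seq R) : Prop :=
  forall x, exists n,
    halted M (run B M x n) /\ decode (cells (run B M x n)) = Some (f x).

Definition char_fun (R : realType) (B : set (seq R)) (x : seq R) : seq R :=
  [:: if `[< B x >] then 1 else 0].

Definition bss_le (R : realType) (B A : set (seq R)) : Prop :=
  exists M : program R, bss_computes A M (char_fun B).

(** * Algebraic numbers of prescribed degree *)

Definition is_min_poly (R : realType) (x : R) (p : {poly rat}) : Prop :=
  [/\ p \is monic, irreducible_poly p & root (map_poly ratr p) x].

Definition algebraic_eq (R : realType) (d : nat) : set R :=
  [set x | exists2 p, is_min_poly x p & size p = d.+1].

(* Real numbers are regarded as tuples of length one. *)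
Definition algebraic_in (R : realType) (S : set nat) : set (seq R) :=
  [set [:: x] | x in \bigcup_(d in S) @algebraic_eq R d].

(* Main.v *)
(** If [S] is contained in [T], one query to the oracle for A_T either refutes
    membership in A_S or guarantees that the input [y] is algebraic. A machine
    with a single real parameter then finishes without the oracle: the base-6
    digits of the parameter are commands which successively evaluate at [y], by
    Horner's rule, all irreducible rational polynomials, each followed by the
    answer to be given in case it vanishes at [y].

    Conversely let p be a prime in [S] but not in [T], and let [y] be
    transcendental over the parameters of a machine. Up to halting, the cells of
    the run on [y] are rational functions of the input, and the run on [x] near
    [y] takes the same path provided g(x) avoids A_T for finitely many
    nonconstant rational functions g. Such an [x] of degree p is found among
    [x = s t + r], with t of degree p and s, r rational. If g takes algebraic
    values at infinitely many algebraic points, it has coefficients in a number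
    field. Let d be the maximal degree of alpha = g(s t + r); then alpha
    satisfies an equation of degree d with coefficients in Q(s, r).
    Differentiating it in r and in s shows that both g'(x) and t g'(x) lie in
    Q(alpha), so t lies in Q(alpha) and p divides the degree of alpha, for
    almost all (s, r). *)

From mathcomp Require Import all_boot all_order all_algebra all_field.
From mathcomp Require Import ring lra.
From mathcomp Require Import boolp classical_sets functions cardinality reals.
From mathcomp Require Import ereal topology normedtype sequences derive measure.
From mathcomp Require Import lebesgue_measure.
Require Import Defs.

Set Implicit Arguments.
Unset Strict Implicit.
Unset Printing Implicit Defensive.

Import Order.TTheory GRing.Theory Num.Theory.
Local Open Scope ring_scope.

(** * Cofinite quantification and linear dependence over polynomials *)

Definition almost_all (T : eqType) (P : T -> Prop) :=
  exists X : seq T, forall x, x \notin X -> P x.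

Lemma almost_allW (T : eqType) (P Q : T -> Prop) :
  (forall x, P x -> Q x) -> almost_all P -> almost_all Q.
Proof. by move=> PQ [X XP]; exists X => x /XP/PQ. Qed.

Lemma almost_allT (T : eqType) (P : T -> Prop) : (forall x, P x) -> almost_all P.
Proof. by move=> p; exists [::]. Qed.

Lemma almost_allI (T : eqType) (P Q : T -> Prop) :
  almost_all P -> almost_all Q -> almost_all (fun x => P x /\ Q x).
Proof.
move=> [X XP] [Y YQ]; exists (X ++ Y) => x.
by rewrite mem_cat negb_or => /andP[/XP ? /YQ].
Qed.

Lemma almost_all_inj (T U : eqType) (f : T -> U) (P : U -> Prop) :
  injective f -> almost_all P -> almost_all (P \o f).
Proof.
move=> fI [X XP].
suff [Y YX] : exists Y : seq T, forall x, f x \in X -> x \in Y.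
  by exists Y => x xY; apply: XP; apply: contra xY => /YX.
elim: X {XP} => [|u X [Y YX]]; first by exists [::].
have [[x <-]|nx] := pselect (exists x, f x = u).
  by exists (x :: Y) => z; rewrite !inE (inj_eq fI) => /orP[->|/YX->]; rewrite ?orbT.
by exists Y => z; rewrite inE => /orP[/eqP fz|/YX//]; case: nx; exists z.
Qed.

Lemma almost_all_nonroot (R : idomainType) (p : {poly R}) :
  p != 0 -> almost_all (fun x => p.[x] != 0).
Proof.
have [n] := ubnP (size p); elim: n p => // n IHn p sp p0.
have [[x px]|nx] := pselect (exists x, root p x); last first.
  by exists [::] => x _; apply/negP => px; apply: nx; exists x.
have [q pE] := factor_theorem _ _ px.
have q0 : q != 0 by apply: contraNneq p0 => q0; rewrite pE q0 mul0r.
have [|//|X XP] := IHn q.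
  by rewrite ltnS in sp; apply: leq_trans sp; rewrite pE size_Mmonic ?monicXsubC // size_XsubC addn2.
exists (x :: X) => y; rewrite inE negb_or pE hornerM hornerXsubC mulf_eq0 subr_eq0.
by case/andP=> /negPf-> /XP/negPf->.
Qed.

Lemma almost_all_inhabited (P : nat -> Prop) : almost_all P -> exists n, P n.
Proof.
move=> [X XP]; exists (\max_(i <- X) i).+1; apply: XP; apply/negP => inX.
by have := @leq_bigmax_seq _ X xpredT id _ inX isT; rewrite ltnn.
Qed.

Lemma almost_all_rat_inhabited (P : rat -> Prop) : almost_all P -> exists w, P w.
Proof.
have natI : injective (fun n : nat => n%:R : rat) by move=> i j /eqP; rewrite eqr_nat => /eqP.
by move=> /(almost_all_inj natI)/almost_all_inhabited[n ?]; exists n%:R.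
Qed.

Lemma tofrac_ratio (R : idomainType) (x : {fraction R}) :
  exists2 p : R * R, p.2 != 0 & x = FracField.tofrac p.1 / FracField.tofrac p.2.
Proof.
elim/quotW: x => r; exists (frac r); first exact: denom_ratioP.
apply: (canRL (mulfK _)); first by rewrite tofrac_eq0 denom_ratioP.
rewrite /=; unlock FracField.tofrac; rewrite -[LHS]FracField.pi_mul.
apply/eqmodP; rewrite /= FracField.equivfE /FracField.mulf /=.
by rewrite !numden_Ratio ?mulf_neq0 ?oner_neq0 ?denom_ratioP // !mulr1 mulrC.
Qed.

Lemma common_denominator (R : idomainType) n (v : 'rV[{fraction R}]_n) :
  exists2 d : R, d != 0 & exists u : 'rV[R]_n,
    FracField.tofrac d *: v = map_mx (@FracField.tofrac R) u.
Proof.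
have /fin_all_exists2[p p2 pE] i := tofrac_ratio (v 0 i).
exists (\prod_i (p i).2); first by apply/prodf_neq0 => i _; exact: p2.
exists (\row_i ((p i).1 * \prod_(j | j != i) (p j).2)).
apply/rowP => i; rewrite !mxE pE (bigD1 i) //= !rmorphM /=.
rewrite [_ / _]mulrC mulrACA mulfV ?mul1r ?tofrac_eq0 //; exact: mulrC.
Qed.

(** Linear algebra over the fraction field: dependent rows give a kernel vector, which a common
    denominator brings back into [R]; independent rows give a nonzero maximal minor. *)
Lemma row_kernel_or_minor (R : idomainType) m n (B : 'M[R]_(m, n)) :
  (exists2 v : 'rV[R]_m, v != 0 & v *m B = 0) \/
  (exists f : 'I_m -> 'I_n, \det (colsub f B) != 0).
Proof.
pose A := map_mx (@FracField.tofrac R) B.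
have [Afree|] := boolP (row_free A).
  right; have Afull : row_full A^T by rewrite /row_full mxrank_tr.
  exists (fullrankfun Afull); have := fullrowsub_unit Afull.
  rewrite -unitmx_tr trmx_mxsub trmxK unitmxE unitfE -map_mxsub det_map_mx.
  by rewrite tofrac_eq0.
rewrite -kermx_eq0 => /rowV0Pn[v /sub_kermxP vA v0]; left.
have [d d0 [u uE]] := common_denominator v; exists u.
  apply: contraNneq v0 => u0; move: uE; rewrite u0 map_mx0 => /eqP.
  by rewrite scalemx_eq0 tofrac_eq0 (negPf d0).
have uA : map_mx (@FracField.tofrac R) (u *m B) = 0.
  by rewrite map_mxM -uE -scalemxAl vA scaler0.
apply/matrixP => i j; have /matrixP/(_ i j) := uA.
by rewrite [LHS]mxE [RHS]mxE => /eqP; rewrite tofrac_eq0 [RHS]mxE => /eqP.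
Qed.

(** Expanding the [P j] in a Q-basis of [L] gives a matrix [B] over Q[X]. A kernel row of [B] is a
    relation with polynomial coefficients. A nonzero minor has finitely many roots, and at any other
    [w] the specialised rows stay independent. *)
Lemma relation_or_generic (L : fieldExtType rat) m (P : 'I_m -> {poly L}) :
  (exists k : 'I_m -> {poly rat}, (exists j, k j != 0) /\
     \sum_j map_poly (in_alg L) (k j) * P j = 0) \/
  almost_all (fun w => forall c : 'I_m -> rat,
     \sum_j (c j)%:A * (P j).[w%:A] = 0 -> forall j, c j = 0).
Proof.
pose e := vbasis {:L}; pose n : nat := \dim {:L}.
pose B : 'M[{poly rat}]_(m, n) :=
  \matrix_(j, i) \poly_(l < size (P j)) coord e i (P j)`_l.
have PE j : P j = \sum_(i < n) e`_i *: map_poly (in_alg L) (B j i).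
  apply/polyP => l; rewrite coef_sum.
  rewrite [LHS](coord_vbasis (memvf _)); apply: eq_bigr => i _.
  rewrite coefZ coef_map mxE coef_poly mulrC /=.
  rewrite mulr_algl; case: ltnP => // sP.
  by rewrite nth_default ?linear0 ?scale0r.
have [[v v0 vB]|[f detf]] := row_kernel_or_minor B; [left|right].
  exists (v 0); split; first exact/rV0Pn.
  under eq_bigr => j _ do rewrite PE mulr_sumr.
  rewrite exchange_big big1 //= => i _.
  under eq_bigr => j _ do rewrite -scalerAr -rmorphM.
  rewrite -scaler_sumr -rmorph_sum /=; have /rowP/(_ i) := vB.
  by rewrite !mxE => ->; rewrite rmorph0 scaler0.
apply: almost_allW (almost_all_nonroot detf) => w detw c cP.
pose M := map_mx (horner_eval w) (colsub f B).
pose u := \row_j c j.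
suff uM : u *m M = 0.
  have /rowP u0 : u = 0.
    apply/eqP; apply: contraNT detw => u0.
    suff: \det M == 0 by rewrite det_map_mx.
    by apply/det0P; exists u.
  by move=> j; have := u0 j; rewrite !mxE.
have eB : basis_of fullv e := vbasisP _.
have/freeP efree := basis_free eB.
have key i : \sum_j c j * (B j i).[w] = 0.
  apply: (efree (fun i => \sum_j c j * (B j i).[w])).
  rewrite -[RHS]cP; under [RHS]eq_bigr => j _ do
    rewrite PE horner_sum mulr_sumr.
  rewrite exchange_big; apply: eq_bigr => /= l _.
  rewrite scaler_suml; apply: eq_bigr => j _.
  by rewrite hornerZ horner_map /= !mulr_algl mulr_algr scalerA.
by apply/rowP => i; rewrite !mxE -[RHS](key (f i)); apply: eq_bigr => j _; rewrite !mxE.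
Qed.

(** * Number fields: differentiating an algebraic relation *)

(* For [e != 0]: the first [d] powers of [n / e] are independent over Q. The
   homogeneous form is polynomial in [n] and [e]. *)
Definition powers_free (L : fieldExtType rat) d (n e : L) :=
  forall c : 'I_d -> rat,
    \sum_j (c j)%:A * (n ^+ j * e ^+ (d.-1 - j)) = 0 -> forall j, c j = 0.

Lemma powers_free_root (L : fieldExtType rat) d (n e : L) :
  e != 0 -> powers_free d n e ->
  forall q : {poly rat}, (size q <= d)%N -> root (map_poly (in_alg L) q) (n / e) ->
    q = 0.
Proof.
move=> e0 free q sq /rootP qr.
have q0 : forall j : 'I_d, q`_j = 0.
  apply: (free (fun j => q`_j)).
  apply: (@mulIf _ (e ^+ d.-1)^-1); first by rewrite invr_eq0 expf_neq0.
  rewrite mul0r -[RHS]qr (horner_coef_wide _ (leq_trans (size_poly _ _) sq)).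
  rewrite mulr_suml; apply: eq_bigr => j _.
  rewrite coef_map /= exprMn exprVn expfB_cond; last first.
    by rewrite (negPf e0) /= add0n -ltnS prednK ?ltn_ord // (leq_ltn_trans _ (ltn_ord j)).
  by field; rewrite !expf_neq0.
apply/polyP => j; rewrite coef0; have [jd|dj] := ltnP j d.
  exact: (q0 (Ordinal jd)).
by rewrite nth_default // (leq_trans sq).
Qed.

(* A relation vanishing at [w] can be divided by ['X - w]. *)
Lemma relation_nonzero_at (L : fieldExtType rat) m (P : 'I_m -> {poly L})
    (k : 'I_m -> {poly rat}) (j : 'I_m) (w : rat) :
  k j != 0 -> \sum_i map_poly (in_alg L) (k i) * P i = 0 ->
  exists k' : 'I_m -> {poly rat},
    (exists i, (k' i).[w] != 0) /\ \sum_i map_poly (in_alg L) (k' i) * P i = 0.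
Proof.
have [n] := ubnP (size (k j)); elim: n k => // n IHn k; rewrite ltnS => sk kj rel.
have [nz|z] := pselect (exists i, (k i).[w] != 0); first by exists k.
have /fin_all_exists[k' kE] i : exists q, k i = q * ('X - w%:P).
  apply/factor_theorem; apply: contrapT => nz; apply: z; exists i.
  exact/negP.
apply: (IHn k').
- apply: leq_trans sk; rewrite kE size_Mmonic ?monicXsubC ?size_XsubC ?addn2 //.
  by apply: contraNneq kj => k0; rewrite kE k0 mul0r.
- by apply: contraNneq kj => k0; rewrite kE k0 mul0r.
- apply: (@mulIf _ (map_poly (in_alg L) ('X - w%:P))).
    by rewrite map_poly_eq0 polyXsubC_eq0.
  rewrite mul0r -[RHS]rel mulr_suml; apply: eq_bigr => i _.
  by rewrite kE rmorphM /= mulrAC.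
Qed.

Lemma mul_deriv_exp (L : fieldType) (p : {poly L}) n :
  p * (p ^+ n)^`() = p^`() * p ^+ n *+ n.
Proof.
rewrite deriv_exp; case: n => [|n]; first by rewrite !mulr0n mulr0.
by rewrite mulrnAr exprS /= mulrCA.
Qed.

(** The first summand carries the Wronskian, the numerator of (N/D)'. The second is the monomial
    itself times a factor independent of [j], so it cancels when a relation among the monomials is
    differentiated. *)
Lemma deriv_homog (L : fieldType) (N D : {poly L}) d j : (j <= d)%N ->
  D * (N ^+ j * D ^+ (d - j))^`() =
  (N ^+ j.-1 * D ^+ (d - j) *+ j) * (N^`() * D - N * D^`())
  + D^`() * (N ^+ j * D ^+ (d - j)) *+ d.
Proof.
move=> jd; rewrite derivM mulrDr.
have -> : D * (N ^+ j * (D ^+ (d - j))^`()) = N ^+ j * (D * (D ^+ (d - j))^`()).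
  by rewrite mulrCA.
rewrite mul_deriv_exp deriv_exp.
have -> (Y : {poly L}) : Y *+ d = Y *+ (d - j) + Y *+ j by rewrite -mulrnDr subnK.
case: j jd => [|j] jd; first by rewrite !mulr0n; ring.
rewrite /= exprS; ring.
Qed.

(** Put g = N/D and a = g(w). No value of g at a rational point has degree above d+1, so the powers
    of g up to d+1 satisfy a relation with coefficients k_i in Q[X]. Differentiating it at w gives
    g'(w) M'(a) = - K(a), where [M] and [K] have the coefficients k_i(w) and k_i'(w). *)
Lemma deriv_mem_adjoin (L : fieldExtType rat) (N D : {poly L}) d (w : rat) :
  D.[w%:A] != 0 -> powers_free d.+1 N.[w%:A] D.[w%:A] ->
  (forall w, ~ powers_free d.+2 N.[w%:A] D.[w%:A]) ->
  (N^`() * D - N * D^`()).[w%:A] / D.[w%:A] ^+ 2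
    \in <<1; N.[w%:A] / D.[w%:A]>>%VS.
Proof.
set e := D.[_]; set n := N.[_]; set V := _ - _; set W := V.[_]; set a := n / e.
move=> e0 free dep.
pose P (j : 'I_d.+2) := N ^+ j * D ^+ (d.+1 - j).
have [[k [[j kj] rel]]|/almost_all_rat_inhabited[v vP]] := relation_or_generic P; last first.
  case: (dep v) => c cP; apply: vP; rewrite -[RHS]cP.
  by apply: eq_bigr => i _; rewrite hornerM !horner_exp.
have {k j kj rel}[k [[j kj] rel]] := relation_nonzero_at w kj rel.
pose M := \poly_(i < d.+2) (k (inord i)).[w].
pose K := \poly_(i < d.+2) (k (inord i))^`().[w].
have sumE (q : {poly rat}) : (size q <= d.+2)%N ->
    (map_poly (in_alg L) q).[a] = \sum_(i < d.+2) (q`_i)%:A * a ^+ i.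
  move=> sq; rewrite (horner_coef_wide _ (leq_trans (size_poly _ _) sq)).
  by apply: eq_bigr => i _; rewrite coef_map.
have Mi (i : 'I_d.+2) : M`_i = (k i).[w] by rewrite coef_poly ltn_ord inord_val.
have Ki (i : 'I_d.+2) : K`_i = (k i)^`().[w] by rewrite coef_poly ltn_ord inord_val.
have sM : (size M <= d.+2)%N by exact: size_poly.
have monE (i : 'I_d.+2) : n ^+ i * e ^+ (d.+1 - i) = e ^+ d.+1 * a ^+ i.
  rewrite exprMn exprVn expfB_cond ?(negPf e0) ?add0n -1?ltnS //.
  by field; rewrite !expf_neq0.
have Ma : (map_poly (in_alg L) M).[a] = 0.
  apply: (@mulfI _ (e ^+ d.+1)); first by rewrite expf_neq0.
  rewrite mulr0 sumE // mulr_sumr -[RHS](horner0 w%:A) -rel horner_sum.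
  apply: eq_bigr => i _; rewrite hornerM horner_map /= Mi hornerM !horner_exp.
  by rewrite monE mulrCA.
have M0 : M != 0.
  by apply: contraNneq kj => M0; rewrite -Mi M0 coef0.
(* The derivative of [M] has degree at most d, below that of [a]. If it vanished at [a] it would be
   zero, and [M] would be a constant vanishing at [a], hence zero. *)
have M'a : (map_poly (in_alg L) M^`()).[a] != 0.
  apply/negP => /eqP M'0; have /eqP[] := M0.
  have dM : M^`() = 0.
    apply: (powers_free_root e0 free); last exact/rootP.
    by rewrite -ltnS (leq_trans (lt_size_deriv M0)).
  have sM1 : (size M <= 1)%N.
    apply/leq_sizeP => -[//|i] _; have /polyP/(_ i)/eqP := dM.
    by rewrite coef_deriv coef0 mulrn_eq0 => /eqP.
  move: Ma; rewrite (size1_polyC sM1) map_polyC hornerC /= => /eqP.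
  by rewrite scaler_eq0 oner_eq0 orbF => /eqP->.
have WE : W = N^`().[w%:A] * e - n * D^`().[w%:A] by rewrite /W /V hornerD hornerN !hornerM.
have key : W / e ^+ 2 * (map_poly (in_alg L) M^`()).[a] = - (map_poly (in_alg L) K).[a].
  have KE : (map_poly (in_alg L) K).[a] = \sum_(i < d.+2) (K`_i)%:A * a ^+ i.
    by rewrite sumE // size_poly.
  have M'E : (map_poly (in_alg L) M^`()).[a]
      = \sum_(i < d.+2) (M`_i)%:A * (a ^+ i.-1 *+ i).
    have sM' : (size (map_poly (in_alg L) M^`()) <= d.+1)%N.
      by rewrite size_map_poly -ltnS (leq_trans (lt_size_deriv M0)).
    rewrite big_ord_recl mulr0n mulr0 add0r (horner_coef_wide _ sM').
    apply: eq_bigr => i _; rewrite lift0 coef_map coef_deriv /=.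
    by rewrite -scalerMnl mulrnAl mulrnAr.
  apply/eqP; rewrite -subr_eq0 opprK; apply/eqP.
  apply: (@mulfI _ (e ^+ d.+2)); first by rewrite expf_neq0.
  rewrite mulr0.
  have <- : (D * (\sum_i map_poly (in_alg L) (k i) * P i)^`()).[w%:A] = 0.
    by rewrite rel deriv0 mulr0 horner0.
  have -> : (D * (\sum_i map_poly (in_alg L) (k i) * P i)^`()).[w%:A] =
      \sum_(i < d.+2) ((K`_i)%:A * (e ^+ d.+2 * a ^+ i) +
        (M`_i)%:A * (W * (e ^+ d * (a ^+ i.-1 *+ i)) +
         D^`().[w%:A] * (e ^+ d.+1 * a ^+ i) *+ d.+1)).
    rewrite raddf_sum mulr_sumr horner_sum; apply: eq_bigr => i _ /=.
    rewrite derivM mulrDr (mulrCA D (map_poly _ _) (P i)^`()) deriv_homog; last by rewrite -ltnS.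
    rewrite deriv_map !(hornerD, hornerM, hornerMn, horner_exp) !horner_map /=.
    rewrite -/e -/n Mi Ki !monE.
    have -> : n ^+ i.-1 * e ^+ (d.+1 - i) *+ i = e ^+ d * (a ^+ i.-1 *+ i).
      case: (nat_of_ord i) (ltn_ord i) => [|l]; first by rewrite !mulr0n mulr0.
      rewrite !ltnS /= subSS => ld; rewrite mulrnAr; congr (_ *+ _).
      by rewrite exprMn exprVn expfB_cond ?(negPf e0) ?add0n //; field; rewrite !expf_neq0.
    by rewrite hornerN hornerM -/n WE [e ^+ d.+2]exprS; ring.
  have Mz : \sum_(i < d.+2) (M`_i)%:A * a ^+ i = 0 by rewrite -sumE.
  transitivity (e ^+ d.+2 * (\sum_(i < d.+2) (K`_i)%:A * a ^+ i)
    + W * e ^+ d * (\sum_(i < d.+2) (M`_i)%:A * (a ^+ i.-1 *+ i))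
    + D^`().[w%:A] * e ^+ d.+1 * d.+1%:R * (\sum_(i < d.+2) (M`_i)%:A * a ^+ i)).
    rewrite KE M'E Mz; move: (\sum_(i < _) _) (\sum_(i < _) _) => SK SM.
    by rewrite !exprS expr0; move: (e ^+ d) => E; field.
  rewrite !mulr_sumr -!big_split /=; apply: eq_bigr => i _.
  by rewrite -(mulr_natr _ d.+1); ring.
have -> : W / e ^+ 2 = - (map_poly (in_alg L) K).[a] / (map_poly (in_alg L) M^`()).[a].
  by rewrite -key mulfK.
have polyA (q : {poly rat}) : (map_poly (in_alg L) q).[a] \in <<1; a>>%VS.
  by apply: mempx_Fadjoin; apply/polyOver1P; exists q.
by rewrite rpredM ?rpredN ?rpredV.
Qed.

Lemma powers_free_dim (L : fieldExtType rat) d (n e : L) :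
  powers_free d n e -> (d <= \dim {:L})%N.
Proof.
move=> nfree; pose X := [tuple n ^+ j * e ^+ (d.-1 - j) | j < d].
have /eqP <- : \dim <<X>> == d.
  have: free X.
    apply/freeP => c cX; apply: nfree; rewrite -[RHS]cX.
    by apply: eq_bigr => j _; rewrite -tnth_nth tnth_mktuple mulr_algl.
  by rewrite /free size_tuple.
exact/dimvS/subvf.
Qed.

(** Otherwise there is a relation over Q[X]; divided by a power of X - w, it specialises to a
    nontrivial relation at the given [w]. *)
Lemma powers_free_almost_all (L : fieldExtType rat) d (N D : {poly L}) (w : rat) :
  powers_free d N.[w%:A] D.[w%:A] ->
  almost_all (fun w : rat => powers_free d N.[w%:A] D.[w%:A]).
Proof.
move=> wfree; pose P (j : 'I_d) := N ^+ j * D ^+ (d.-1 - j).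
have PE (j : 'I_d) (x : L) : (P j).[x] = N.[x] ^+ j * D.[x] ^+ (d.-1 - j).
  by rewrite hornerM !horner_exp.
have [[k [[j kj] rel]]|] := relation_or_generic P; last first.
  apply: almost_allW => v vP c cP; apply: vP; rewrite -[RHS]cP.
  by apply: eq_bigr => j _; rewrite PE.
have {k j kj rel}[k [[j kj] rel]] := relation_nonzero_at w kj rel.
case/eqP: kj; apply: (wfree (fun j => (k j).[w])).
rewrite -[RHS](horner0 w%:A) -rel horner_sum; apply: eq_bigr => i _.
by rewrite hornerM horner_map PE.
Qed.

(** Let d+1 be the largest degree of a value of g = N/D at a point u = s t + r. Varying r alone and
    s alone, [deriv_mem_adjoin] puts g'(u) and t g'(u) into Q(g(u)). Where the Wronskian [V] does
    not vanish, t is their quotient. *)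
Lemma mem_adjoin_almost_all (L : fieldExtType rat) (N D : {poly L}) (t : L) :
  D != 0 -> N^`() * D - N * D^`() != 0 -> t != 0 ->
  almost_all (fun r : rat => almost_all (fun s : rat =>
    t \in <<1; N.[s%:A * t + r%:A] / D.[s%:A * t + r%:A]>>%VS)).
Proof.
move=> D0; set V := _ - _ => V0 t0.
pose pf d (s r : rat) := powers_free d N.[s%:A * t + r%:A] D.[s%:A * t + r%:A].
have ex0 : exists d, `[< exists s r, pf d.+1 s r >].
  exists 0%N; apply/asboolP; exists 0, 0 => c.
  rewrite big_ord1 !expr0 !mulr1 => /eqP; rewrite scaler_eq0 oner_eq0 orbF => /eqP c0 j.
  by rewrite ord1.
have bnd d : `[< exists s r, pf d.+1 s r >] -> (d <= \dim {:L})%N.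
  by move=> /asboolP[s [r /powers_free_dim/ltnW]].
case: (ex_maxnP ex0 bnd) => d /asboolP[s1 [r1 free1]] dmax.
have dep s r : ~ pf d.+2 s r.
  move=> free2; have: (d.+1 <= d)%N by apply: dmax; apply/asboolP; exists s, r.
  by rewrite ltnn.
pose lineR s : {poly L} := 'X + (s%:A * t)%:P.
pose lineS (r : rat) : {poly L} := t *: 'X + (r%:A)%:P.
have lineRE s r (p : {poly L}) : (p \Po lineR s).[r%:A] = p.[s%:A * t + r%:A].
  by rewrite horner_comp hornerD hornerX hornerC addrC.
have lineSE s r (p : {poly L}) : (p \Po lineS r).[s%:A] = p.[s%:A * t + r%:A].
  by rewrite horner_comp hornerD hornerZ hornerX hornerC mulrC.
(* Independence at the single point (s1, r1) spreads first along r with s1 fixed, then along s for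
   each good r. *)
have /(almost_allW _) : almost_all (fun r => pf d.+1 s1 r).
  have := @powers_free_almost_all L d.+1 (N \Po lineR s1) (D \Po lineR s1) r1.
  by rewrite !lineRE => /(_ free1); apply: almost_allW => r; rewrite !lineRE.
apply=> r pfr.
have pfs : almost_all (fun s => pf d.+1 s r).
  have := @powers_free_almost_all L d.+1 (N \Po lineS r) (D \Po lineS r) s1.
  by rewrite !lineSE => /(_ pfr); apply: almost_allW => s; rewrite !lineSE.
have uI : injective (fun s : rat => s%:A * t + r%:A).
  by move=> a b /addIr /(mulIf t0); rewrite -!in_algE => /fmorph_inj.
have := almost_allI pfs (almost_allI (almost_all_inj uI (almost_all_nonroot D0))
  (almost_all_inj uI (almost_all_nonroot V0))).
apply: almost_allW => s [free0 /= [Du Vu]].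
set u := s%:A * t + r%:A in Du Vu *.
have VE : V.[u] = N^`().[u] * D.[u] - N.[u] * D^`().[u].
  by rewrite /V hornerD hornerN !hornerM.
have memR : V.[u] / D.[u] ^+ 2 \in <<1; N.[u] / D.[u]>>%VS.
  have := @deriv_mem_adjoin L (N \Po lineR s) (D \Po lineR s) d r.
  rewrite !lineRE -/u => /(_ Du free0) memR.
  rewrite VE; move: memR; rewrite !deriv_comp derivD derivX derivC addr0 !mulr1.
  by rewrite hornerD hornerN !hornerM !lineRE -/u; apply => w; rewrite !lineRE; exact: dep.
have memS : t * (V.[u] / D.[u] ^+ 2) \in <<1; N.[u] / D.[u]>>%VS.
  have := @deriv_mem_adjoin L (N \Po lineS r) (D \Po lineS r) d s.
  rewrite !lineSE -/u => /(_ Du free0) memS.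
  have -> : t * (V.[u] / D.[u] ^+ 2) =
      (N^`().[u] * t * D.[u] - N.[u] * (D^`().[u] * t)) / D.[u] ^+ 2.
    by rewrite VE; ring.
  move: memS; rewrite !deriv_comp derivD derivZ derivX derivC addr0.
  rewrite hornerD hornerN !hornerM !lineSE hornerZ hornerC mulr1 -/u.
  by apply => w; rewrite !lineSE; exact: dep.
have -> : t = t * (V.[u] / D.[u] ^+ 2) / (V.[u] / D.[u] ^+ 2).
  by rewrite mulfK // mulf_neq0 ?invr_eq0 ?expf_neq0.
by rewrite rpredM ?rpredV.
Qed.

(** * Real algebraic numbers *)

(** If N had smaller degree than D, the leading coefficients of the two sides would be the same
    nonzero product multiplied by deg N and by deg D, which differ in characteristic 0. *)
Lemma wronskian0_size (F : fieldType) (N D : {poly F}) :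
  [pchar F] =i pred0 -> N != 0 -> D != 0 -> N^`() * D = N * D^`() ->
  (size D <= size N)%N.
Proof.
move=> F0 N0 D0 eqW; have nat0 := (pcharf0P F).1 F0.
have leadD (P : {poly F}) : (1 < size P)%N ->
    size P^`() = (size P).-1 /\ lead_coef P^`() = lead_coef P *+ (size P).-1.
  move=> sP; have P0 : P != 0 by rewrite -size_poly_gt0 ltnW.
  have top : P^`()`_(size P).-2 = lead_coef P *+ (size P).-1.
    by rewrite coef_deriv lead_coefE prednK // -subn1 subn_gt0.
  have top0 : P^`()`_(size P).-2 != 0.
    by rewrite top -mulr_natr mulf_neq0 ?lead_coef_eq0 // nat0 -subn1 subn_eq0 -ltnNge.
  have sP' : size P^`() = (size P).-1.
    apply/eqP; rewrite eqn_leq -ltnS prednK ?(ltnW sP) // lt_size_deriv //=.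
    rewrite leqNgt; apply: contraNN top0 => lt; rewrite nth_default //.
    by rewrite -ltnS prednK // -subn1 subn_gt0.
  by split=> //; rewrite -top lead_coefE sP'.
rewrite leqNgt; apply/negP => ltND.
have sD : (1 < size D)%N by rewrite (leq_trans _ ltND) // ltnS size_poly_gt0.
have [sD' lD'] := leadD _ sD.
have [sN|sN] := leqP (size N) 1.
  move: eqW; rewrite [in N^`()](size1_polyC sN) derivC mul0r => /esym/eqP.
  rewrite mulf_eq0 (negPf N0) /= -size_poly_eq0 sD' -subn1 subn_eq0.
  by rewrite leqNgt sD.
have [sN' lN'] := leadD _ sN.
have := congr1 lead_coef eqW; rewrite !lead_coefM lD' lN' mulrnAl mulrnAr.
have lt : ((size N).-1 < (size D).-1)%N by rewrite -ltnS !prednK // ltnW.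
rewrite -(subnKC (ltnW lt)) mulrnDr -[LHS]addr0 => /addrI/esym/eqP.
rewrite -mulr_natr !mulf_eq0 !lead_coef_eq0 (negPf N0) (negPf D0) nat0.
by rewrite subn_eq0 leqNgt lt.
Qed.

(** Subtracting the multiple of [D] with the same leading coefficient keeps the Wronskian zero but
    lowers the size below that of [D], so the previous bound leaves only 0. *)
Lemma wronskian0 (F : fieldType) (N D : {poly F}) :
  [pchar F] =i pred0 -> D != 0 -> N^`() * D - N * D^`() = 0 ->
  exists c, N = c *: D.
Proof.
move=> F0 D0 /eqP; rewrite subr_eq0 => /eqP eqW.
have [->|N0] := eqVneq N 0; first by exists 0; rewrite scale0r.
pose c := lead_coef N / lead_coef D; exists c.
have sND : size N = size D.
  by apply/eqP; rewrite eqn_leq !wronskian0_size // mulrC -eqW mulrC.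
apply/eqP; rewrite -subr_eq0; apply: contraT => E0.
have : (size D <= size (N - c *: D)%R)%N.
  apply: wronskian0_size => //.
  by rewrite derivB derivZ !mulrBl eqW -!scalerAl [D * _]mulrC.
have lE : (N - c *: D)`_(size D).-1 = 0.
  rewrite coefB coefZ -(lead_coefE D) -sND -(lead_coefE N) mulfVK ?subrr //.
  by rewrite lead_coef_eq0.
have leE : (size (N - c *: D)%R <= size D)%N.
  by rewrite (leq_trans (size_polyD _ _)) // size_polyN sND geq_max leqnn size_scale_leq.
move=> geE; have sE : size (N - c *: D) = size D by apply/eqP; rewrite eqn_leq leE.
by move: lE; rewrite -sE -lead_coefE => /eqP; rewrite lead_coef_eq0 (negPf E0).
Qed.

Lemma algebraic_min_poly (R : realType) (x : R) :
  algebraicOver ratr x -> exists p, is_min_poly x p.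
Proof.
move=> [p0 p00 rp0].
have ex : exists n, `[< exists2 p : {poly rat}, (p != 0) && (size p == n)
    & root (map_poly ratr p) x >].
  by exists (size p0); apply/asboolP; exists p0; rewrite // p00 eqxx.
case: (ex_minnP ex) => n /asboolP[p /andP[p_neq0 /eqP sp] rp] nmin.
have pmin q : root (map_poly ratr q) x -> q != 0 -> (size p <= size q)%N.
  by move=> rq q0; rewrite sp; apply: nmin; apply/asboolP; exists q; rewrite // q0 eqxx.
have irr_p : irreducible_poly p by apply/(subfx_irreducibleP rp p_neq0).
exists ((lead_coef p)^-1 *: p); split.
- by rewrite monicE lead_coefZ mulVf ?lead_coef_eq0.
- have [sp1 irr] := irr_p; have lp0 : (lead_coef p)^-1 != 0 by rewrite invr_eq0 lead_coef_eq0.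
  split=> [|q sq]; first by rewrite size_scale.
  by rewrite dvdpZr // => /irr -/(_ sq) /eqp_trans; apply; rewrite eqp_sym eqp_scale.
- by rewrite map_polyZ /= rootZ // fmorph_eq0 invr_eq0 lead_coef_eq0.
Qed.

Lemma real_PET (R : realType) (s : seq R) :
  (forall x, x \in s -> algebraicOver ratr x) ->
  exists2 z : R, algebraicOver ratr z &
    exists ps : seq {poly rat}, s = [seq (map_poly ratr p).[z] | p <- ps].
Proof.
elim: s => [|x s IHs] alg.
  by exists 0; [apply: algebraic0 | exists [::]].
have [z algz [ps Ds]] : exists2 z : R, algebraicOver ratr z &
    exists ps : seq {poly rat}, s = [seq (map_poly ratr p).[z] | p <- ps].
  by apply: IHs => y ys; apply: alg; rewrite inE ys orbT.
have algx : algebraicOver ratr x by apply: alg; rewrite inE eqxx.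
have [rx nz_rx rx0] := algx.
have [rz nz_rz rz0] := algebraic_opp algz.
have pchar0_Q: [pchar rat] =i pred0 by apply: pchar_num.
have [n [[pz Dpz] [px Dpx]]] := pchar0_PET nz_rz rz0 nz_rx rx0 pchar0_Q.
exists (x *+ n - (- z)).
  apply: algebraic_sub; last exact: algebraic_opp.
  by rewrite -mulr_natr; apply: algebraic_mul => //; rewrite -(ratr_nat R); apply: algebraic_id.
exists (px :: [seq p \Po (- pz) | p <- ps]); rewrite /= Dpx; congr (_ :: _).
rewrite -map_comp Ds; apply: eq_map => p /=.
by rewrite map_comp_poly horner_comp rmorphN hornerN Dpz opprK.
Qed.

(** By the primitive element theorem one quotient of Q[X] suffices; degrees of real numbers then
    become dimensions over Q. *)
Lemma number_field_embedding (R : realType) (s : seq R) :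
  (forall x, x \in s -> algebraicOver ratr x) ->
  exists (L : fieldExtType rat) (iota : {rmorphism L -> R}) (s' : seq L),
    s = map iota s'.
Proof.
move=> /real_PET[z /algebraic_min_poly[r [mon_r irr_r rz0]] [ps Ds]].
have nz_r := monic_neq0 mon_r.
exists (SubFieldExtType rz0 irr_r), (@subfx_inj _ _ ratr z r).
exists [seq subfx_eval _ z r p | p <- ps].
by rewrite Ds -map_comp; apply: eq_map => p /=; rewrite subfx_inj_eval.
Qed.

Lemma not_almost_all_seq (T : eqType) (P : T -> Prop) n :
  ~ almost_all P -> exists s : seq T, [/\ uniq s, size s = n & forall x, x \in s -> ~ P x].
Proof.
move=> nP; elim: n => [|n [s [us ss sP]]]; first by exists [::].
have [x [xs nPx]] : exists x, x \notin s /\ ~ P x.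
  apply: contrapT => nex; apply: nP; exists s => x xs.
  by apply: contrapT => nPx; apply: nex; exists x.
exists (x :: s); split; rewrite /= ?xs ?ss // => y.
by rewrite inE => /orP[/eqP->//|/sP].
Qed.

Lemma horner_rVpoly_sum (F : fieldType) d (u : 'rV[F]_d) x :
  (rVpoly u).[x] = \sum_i u 0 i * x ^+ i.
Proof.
rewrite (horner_coef_wide _ (size_poly _ _)); apply: eq_bigr => i _.
by rewrite coef_rVpoly_ord.
Qed.

(** Algebraic values at enough algebraic points constrain N and D by a linear system over a number
    field. It has a nonzero real solution, the coefficients of [N] and [D], hence a nonzero solution
    over the number field. *)
Lemma rational_function_descent (R : realType) (N D : {poly R}) (t : R) :
  algebraicOver ratr t -> D != 0 ->
  (exists (L : fieldExtType rat) (iota : {rmorphism L -> R}) (t1 : L) (N1 D1 : {poly L}),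
     [/\ iota t1 = t, D1 != 0 & N * map_poly iota D1 = map_poly iota N1 * D]) \/
  almost_all (fun x => algebraicOver ratr x -> D.[x] != 0 ->
     ~ algebraicOver ratr (N.[x] / D.[x])).
Proof.
move=> algt D0; set P := fun x : R => _.
have [aP|nP] := pselect (almost_all P); [by right|left].
(* With all sizes at most m, [N * D1 - N1 * D] has degree below 2m, so vanishing at 2m points makes
   it zero. *)
pose m := maxn (size N) (size D); pose n := (m + m)%N.
have [s [us ss sP]] := not_almost_all_seq n nP.
pose g x := N.[x] / D.[x].
have {}sP x : x \in s -> [/\ algebraicOver ratr x, D.[x] != 0 & algebraicOver ratr (g x)].
  move=> /sP nPx; by split; apply: contrapT => h; apply: nPx => // ? ? ?; case: h.
have [|L [iota [s' Es']]] := @number_field_embedding R (t :: s ++ map g s).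
  move=> x; rewrite inE mem_cat => /or3P[/eqP->//|/sP[]//|/mapP[y /sP[_ _ ?] -> //]].
have lift x : x \in t :: s ++ map g s -> exists y, iota y = x.
  by rewrite Es' => /mapP[y _ ->]; exists y.
have [t1 t1E] : exists y, iota y = t by apply: lift; rewrite inE eqxx.
have nths (j : 'I_n) : s`_j \in s by rewrite mem_nth // ss.
have /fin_all_exists[x xE] (j : 'I_n) : exists y, iota y = s`_j.
  by apply: lift; rewrite inE mem_cat nths orbT.
have /fin_all_exists[a aE] (j : 'I_n) : exists y, iota y = g s`_j.
  by apply: lift; rewrite inE mem_cat map_f ?orbT.
(* The left kernel of [M] consists of the coefficients of pairs (N1, D1) with N1(x_j) = a_j D1(x_j)
   for all j. *)
pose M : 'M[L]_(m + m, n) := col_mx (\matrix_(i < m, j < n) x j ^+ i)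
                                    (\matrix_(i < m, j < n) (- a j * x j ^+ i)).
have MR : ~~ row_free (map_mx iota M).
  rewrite -kermx_eq0; apply/rowV0Pn.
  exists (row_mx (poly_rV N : 'rV_m) (poly_rV D)).
    apply/sub_kermxP/rowP => j; rewrite map_col_mx mul_row_col !mxE.
    have szN : (size N <= m)%N by rewrite leq_maxl.
    have szD : (size D <= m)%N by rewrite leq_maxr.
    transitivity (N.[s`_j] - g s`_j * D.[s`_j]).
      rewrite (horner_coef_wide _ szN) (horner_coef_wide _ szD) mulr_sumr -sumrN.
      congr (_ + _); apply: eq_bigr => i _;
        rewrite !mxE ?rmorphM ?rmorphN rmorphXn /= xE ?aE //; ring.
    by rewrite /g divfK ?subrr //; have [] := sP _ (nths j).
  apply: contraNneq D0 => /eqP; rewrite row_mx_eq0 => /andP[_ /eqP rD].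
  by rewrite -[D](poly_rV_K (leq_maxr (size N) (size D))) rD linear0.
(* Rank is invariant under field extension, so the kernel is already nonzero over [L]. *)
move: MR; rewrite row_free_map -kermx_eq0 => /rowV0Pn[u /sub_kermxP uM u0].
pose N1 := rVpoly (lsubmx u); pose D1 := rVpoly (rsubmx u).
exists L, iota, t1, N1, D1.
have evalE j : N1.[x j] = a j * D1.[x j].
  apply/eqP; rewrite -subr_eq0; apply/eqP.
  have /rowP/(_ j) := uM; rewrite -[u]hsubmxK mul_row_col !mxE => <-.
  rewrite !horner_rVpoly_sum mulr_sumr -sumrN.
  by congr (_ + _); apply: eq_bigr => i _; rewrite !mxE //; ring.
have relE : N * map_poly iota D1 = map_poly iota N1 * D.
  apply/eqP; rewrite -subr_eq0; apply: contraT => E0.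
  have := max_poly_roots E0 _ us; rewrite ss ltnNge => /(_ _)/negP F; exfalso; apply: F.
    apply/allP => y ys; have := ys; rewrite -index_mem ss => yj.
    have [_ Dy _] := sP _ ys.
    have yE : iota (x (Ordinal yj)) = y by rewrite xE /= nth_index.
    rewrite rootE !hornerE -yE !horner_map evalE rmorphM /= aE /= nth_index //.
    by rewrite yE /g -subr_eq0; apply/eqP; field.
  rewrite (leq_trans (size_polyD _ _)) // size_polyN geq_max.
  rewrite !(leq_trans (size_polyMleq _ _)) // (leq_trans (leq_pred _)) // leq_add //;
    by rewrite ?size_map_poly ?size_poly ?leq_maxl ?leq_maxr.
split=> //; apply: contraNneq u0 => D10.
move: relE; rewrite D10 map_poly0 mulr0 => /esym/eqP.
rewrite mulf_eq0 (negPf D0) orbF map_poly_eq0 => /eqP N10.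
rewrite -[u]hsubmxK -[lsubmx u]rVpolyK -[rsubmx u]rVpolyK -/N1 -/D1 N10 D10.
by rewrite !linear0 row_mx0.
Qed.

Lemma dim_adjoin_min_poly (R : realType) (L : fieldExtType rat)
    (iota : {rmorphism L -> R}) (a : L) (f : {poly rat}) :
  is_min_poly (iota a) f -> \dim <<1; a>> = (size f).-1.
Proof.
case=> mon_f irr_f froot.
have map_iota (q : {poly rat}) : map_poly iota (map_poly (in_alg L) q) = map_poly ratr q.
  rewrite -map_poly_comp; apply: eq_map_poly => c /=.
  by rewrite -[RHS](fmorph_rat iota) alg_num_field.
have fa : root (map_poly (in_alg L) f) a.
  by move: froot; rewrite -map_iota fmorph_root.
have /polyOver1P[m mE] := minPolyOver 1 a.
have mf : m %| f.
  rewrite -(dvdp_map (in_alg L)) -mE; apply: minPoly_dvdp => //.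
  by apply/polyOver1P; exists f.
have sm : size m = (adjoin_degree 1 a).+1.
  by rewrite -(size_map_poly (in_alg L)) -mE size_minPoly.
have /eqp_size sf : m %= f by apply: irr_f.2 => //; rewrite sm.
by rewrite dim_Fadjoin dimv1 muln1 -sf sm.
Qed.

Lemma min_poly_prime_neq0 (R : realType) (t : R) f p :
  is_min_poly t f -> size f = p.+1 -> prime p -> t != 0.
Proof.
move=> ft sf pp; apply: contraTneq pp => t0; case: ft => _ [_ irr].
rewrite t0 -(rmorph0 ratr) fmorph_root -dvdp_XsubCl => /irr.
rewrite size_XsubC => /(_ isT)/eqp_size.
by rewrite size_XsubC sf => -[<-].
Qed.

(** If N/D descends to a number field, almost every value alpha satisfies t in Q(alpha), so p
    divides the degree of alpha, which is then no other prime. Otherwise almost no algebraic point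
    has an algebraic value. *)
Lemma avoid_degree (R : realType) (N D : {poly R}) (t : R) f p :
  is_min_poly t f -> size f = p.+1 -> prime p -> D != 0 -> (~ exists c, N = c *: D) ->
  almost_all (fun r : rat => almost_all (fun s : rat =>
    forall q, prime q -> q != p ->
      ~ algebraic_eq q (N.[ratr s * t + ratr r] / D.[ratr s * t + ratr r]))).
Proof.
move=> ft sf pp D0 nconst.
have algt : algebraicOver ratr t by case: ft => /monic_neq0 ? _ ?; exists f.
have t0 := min_poly_prime_neq0 ft sf pp.
have uI (r : rat) : injective (fun s : rat => ratr s * t + ratr r : R).
  by move=> x y /addIr/(mulIf t0)/fmorph_inj.
have Dne r := almost_all_inj (uI r) (almost_all_nonroot D0).
have [[L [iota [t1 [N1 [D1 [t1E D10 relE]]]]]]|fin] := rational_function_descent N algt D0.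
  have V0 : N1^`() * D1 - N1 * D1^`() != 0.
    apply/negP => /eqP /wronskian0[//|//|c cE]; last first.
      apply: nconst; exists (iota c).
      apply: (@mulIf _ (map_poly iota D1)); first by rewrite map_poly_eq0.
      by rewrite relE cE map_polyZ /= -scalerAl -scalerAl mulrC.
    by move=> n; rewrite pchar_lalg pchar_num.
  have t10 : t1 != 0 by apply: contraNneq t0 => t10; rewrite -t1E t10 rmorph0.
  have := mem_adjoin_almost_all D10 V0 t10; apply: almost_allW => r Hr.
  have D1ne := almost_all_inj (uI r) (almost_all_nonroot (_ : map_poly iota D1 != 0)).
  apply: almost_allW (almost_allI Hr (almost_allI (Dne r) (D1ne _))); last by rewrite map_poly_eq0.
  move=> s [t1in [/= Du D1u]] q pq qp [g gmin sg].
  set u := ratr s * t + ratr r in Du D1u gmin.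
  pose u1 := s%:A * t1 + r%:A.
  have u1E : iota u1 = u.
    by rewrite rmorphD rmorphM /= t1E !alg_num_field !fmorph_rat.
  have aE : iota (N1.[u1] / D1.[u1]) = N.[u] / D.[u].
    rewrite fmorph_div -!horner_map u1E.
    apply/eqP; rewrite eqr_div // -!hornerM -relE mulrC //.
  rewrite -aE in gmin; rewrite -t1E in ft.
  have := field_dimS (_ : (<<1; t1>> <= <<1; N1.[u1] / D1.[u1]>>)%VS).
  rewrite (dim_adjoin_min_poly gmin) (dim_adjoin_min_poly ft) sf sg /= dvdn_prime2 //.
  rewrite eq_sym (negPf qp) => F; apply: notF; apply: F.
  by apply/FadjoinP; rewrite sub1v.
apply: almost_allT => r; apply: almost_allW (almost_allI (Dne r) (almost_all_inj (uI r) fin)).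
move=> s [/= Du alg] q _ _ [g [/monic_neq0 g0 _ gr] _]; apply: alg => //; last by exists g.
by apply: algebraic_add; [apply: algebraic_mul => //|]; exact: algebraic_id.
Qed.

(** * Points of prime degree with controlled values *)

(** A real p-th root of 2: the intermediate value theorem on [0, 2] gives the root, Eisenstein's
    criterion at 2 the irreducibility. *)
Lemma exists_prime_degree (R : realType) p : prime p ->
  exists (t : R) f, is_min_poly t f /\ size f = p.+1.
Proof.
move=> pp; have p0 := prime_gt0 pp; pose q : {poly int} := 'X^p - 2%:P.
have sq : size q = p.+1 by rewrite size_XnsubC.
have irr : irreducible_poly (map_poly intr q : {poly rat}).
  apply/irreducible_rat_int; apply: (@eisenstein_crit 2) => //.
  - by rewrite sq; case: p p0 {pp q sq}.
  - by rewrite (monicP (monicXnsubC _ _)).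
  - by rewrite coefB coefXn coefC (ltn_eqF p0) eqxx sub0r.
  move=> i; rewrite sq /= => ip; rewrite coefB coefXn coefC (ltn_eqF ip).
  by case: i ip.
have mapE : map_poly intr q = 'X^p - 2%:P :> {poly rat}.
  by rewrite rmorphB /= map_polyXn map_polyC.
have [t _ tr] : exists2 t : R, 0 <= t <= 2 & root ('X^p - 2%:P) t.
  apply: poly_ivt => //; rewrite !hornerE expr0n eqn0Ngt p0 /=.
  rewrite sub0r oppr_le0 ler0n subr_ge0 /=.
  by rewrite -{1}(expr1 2) ler_weXn2l // ler1n.
exists t, (map_poly intr q); rewrite mapE size_XnsubC //; split=> //.
by split; rewrite ?monicXnsubC -?mapE // mapE rmorphB /= map_polyXn map_polyC /= ratr_nat.
Qed.

Lemma affine_degree (R : realType) (t : R) f (r s : rat) :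
  s != 0 -> is_min_poly t f -> algebraic_eq (size f).-1 (ratr s * t + ratr r).
Proof.
move=> s0 ft; set x := _ + _.
have algt : algebraicOver ratr t by case: ft => /monic_neq0 ? _ ?; exists f.
have [|L [iota [[|t1 [|??]] // [tE]]]] := @number_field_embedding R [:: t].
  by move=> y; rewrite inE => /eqP->.
have /algebraic_min_poly[g gx] : algebraicOver ratr x.
  by apply: algebraic_add; [apply: algebraic_mul => //|]; exact: algebraic_id.
exists g => //.
have xE : iota (s%:A * t1 + r%:A) = x.
  by rewrite rmorphD rmorphM /= -tE !alg_num_field !fmorph_rat.
rewrite tE in ft; rewrite -xE in gx.
have [g_gt1 _] : irreducible_poly g by case: gx.
rewrite -(dim_adjoin_min_poly ft) -[LHS]prednK ?(ltnW g_gt1) //.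
rewrite -(dim_adjoin_min_poly gx); congr (_.+1).
have Q1 (c : rat) (U : {subfield L}) : c%:A \in U by rewrite rpredZ ?rpred1.
have s0' : s%:A != 0 :> L by rewrite scaler_eq0 (negPf s0) oner_eq0.
congr (\dim _); apply/eqP; rewrite eqEsubv; apply/andP; split;
  apply/FadjoinP; rewrite sub1v; split=> //.
  by rewrite rpredD ?rpredM ?memv_adjoin ?Q1.
set u := s%:A * t1 + r%:A.
have -> : t1 = (u - r%:A) / s%:A by rewrite addrK mulrC mulKf.
by rewrite rpredM ?rpredV ?rpredB ?memv_adjoin ?Q1.
Qed.

Lemma almost_all_rat_itv (R : realType) (P : rat -> Prop) (a b : R) :
  a < b -> almost_all P -> exists w, [/\ P w, a < ratr w & ratr w < b].
Proof.
move=> ab aP; have [c /itvP cab] := rat_in_itvoo ab.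
have cb : ratr c < b by rewrite cab.
have [d /itvP dcb] := rat_in_itvoo cb.
have cd : c < d by rewrite -(ltr_rat R) dcb.
have wI : injective (fun n : nat => c + (d - c) / n.+2%:R : rat).
  move=> i j /addrI/mulfI; rewrite subr_eq0 (gt_eqF cd) => /(_ isT)/invr_inj/eqP.
  by rewrite eqr_nat => /eqP[].
have [n Pn] := almost_all_inhabited (almost_all_inj wI aP).
exists (c + (d - c) / n.+2%:R); split=> //.
  apply: lt_le_trans (_ : ratr c <= _); first by rewrite cab.
  by rewrite ler_rat lerDl divr_ge0 // subr_ge0 ltW.
apply: le_lt_trans (_ : ratr d < b); last by rewrite dcb.
rewrite ler_rat -lerBrDl ler_pdivrMr // ler_peMr ?subr_ge0 ?(ltW cd) //.
by rewrite ler1n.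
Qed.

Lemma almost_all_seq (T I : eqType) (P : I -> T -> Prop) (s : seq I) :
  (forall i, i \in s -> almost_all (P i)) ->
  almost_all (fun x => forall i, i \in s -> P i x).
Proof.
elim: s => [|i s IHs] aP; first exact: almost_allT.
have ai : almost_all (P i) by apply: aP; rewrite inE eqxx.
have as_ : almost_all (fun x => forall i, i \in s -> P i x).
  by apply: IHs => j js; apply: aP; rewrite inE js orbT.
apply: almost_allW (almost_allI ai as_) => x [Pi Ps] j.
by rewrite inE => /orP[/eqP->|/Ps].
Qed.

Lemma dense_avoid_degree (R : realType) p (G : seq ({poly R} * {poly R})) (a b : R) :
  prime p -> a < b ->
  (forall g, g \in G -> g.2 != 0 /\ ~ exists c, g.1 = c *: g.2) ->
  exists x, [/\ a < x, x < b, algebraic_eq p x & forall g, g \in G ->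
    forall q, prime q -> q != p -> ~ algebraic_eq q (g.1.[x] / g.2.[x])].
Proof.
move=> pp ab Gnc; have [t [f [ft sf]]] := exists_prime_degree R pp.
have t0 := min_poly_prime_neq0 ft sf pp.
pose P (g : {poly R} * {poly R}) (s r : rat) := forall q, prime q -> q != p ->
  ~ algebraic_eq q (g.1.[ratr s * t + ratr r] / g.2.[ratr s * t + ratr r]).
have aP : almost_all (fun r => forall g, g \in G -> almost_all (fun s => P g s r)).
  by apply: almost_all_seq => g /Gnc[g0 gnc]; exact: avoid_degree ft sf pp g0 gnc.
(* The parameter r is fixed first, inside (a, b), because the finitely many bad s depend on it. *)
have [r [Pr ar rb]] := almost_all_rat_itv ab aP.
have s0 : almost_all (fun s : rat => s != 0).
  by exists [:: 0] => s; rewrite inE.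
(* For |s| below this bound, s t + r stays in (a, b). *)
pose e := (Num.min (ratr r - a) (b - ratr r)) / `|t|.
have e0 : - e < e.
  by rewrite gtrN // divr_gt0 ?normr_gt0 // lt_min !subr_gt0 ar.
have [s [[{}s0 sP] sl sr]] := almost_all_rat_itv e0 (almost_allI s0 (almost_all_seq Pr)).
have : `|ratr s * t| < Num.min (ratr r - a) (b - ratr r).
  by rewrite normrM -ltr_pdivlMr ?normr_gt0 // ltr_norml sl.
rewrite lt_min !ltr_norml => /andP[/andP[sa _] /andP[_ sb]].
exists (ratr s * t + ratr r); split; [by lra|by lra| |].
  by have := affine_degree r s0 ft; rewrite sf.
by move=> g /sP.
Qed.

(** * Runs near a generic input *)

Import numFieldNormedType.Exports.
Local Open Scope classical_set_scope.

(** A countable union of finite sets is Lebesgue null, so it is not the whole line. *)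
Lemma almost_all_countable (R : realType) (I : countType) (P : I -> R -> Prop) :
  (forall i, almost_all (P i)) -> exists y, forall i, P i y.
Proof.
move=> /choice[X XP].
have cX : countable (\bigcup_(i in [set: I]) [set` X i]).
  apply: bigcup_countable => [|i _]; first exact: countableP.
  exact/finite_set_countable/finite_seq.
have [y yX] : exists y : R, forall i, y \notin X i.
  apply: contrapT => nex.
  have XT : \bigcup_(i in [set: I]) [set` X i] = [set: R].
    apply/seteqP; split=> // y _; apply: contrapT => nyX; apply: nex; exists y => i.
    by apply/negP => yXi; apply: nyX; exists i.
  have := countable_lebesgue_measure0 cX; rewrite XT -set_itvNyy.
  by rewrite lebesgue_measure_itv /=.
by exists y => i; exact: XP.
Qed.

(* A pair stands for numerator and denominator. *)
Definition ratfun (R : realType) := ({poly R} * {poly R})%type.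

Definition feval (R : realType) (g : ratfun R) (x : R) := g.1.[x] / g.2.[x].

Definition fconst (R : realType) (c : R) : ratfun R := (c%:P, 1).

Lemma fevalC (R : realType) (c x : R) : feval (fconst c) x = c.
Proof. by rewrite /feval hornerC hornerE divr1. Qed.

Definition farith (R : realType) (o : arith) (g h : ratfun R) : ratfun R :=
  match o with
  | OpAdd => (g.1 * h.2 + h.1 * g.2, g.2 * h.2)
  | OpSub => (g.1 * h.2 - h.1 * g.2, g.2 * h.2)
  | OpMul => (g.1 * h.1, g.2 * h.2)
  | OpDiv => (g.1 * h.2, g.2 * h.1)
  end.

Definition parameters (R : realType) (M : program R) : seq R :=
  pmap (fun ins => if ins is Const _ c then Some c else None) M.

(** A finite list containing every rational function that a cell can hold after [n] steps on an
    input of length one; [fconst 1] is the length stored in cell 0. *)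
Fixpoint reachable (R : realType) (M : program R) n : seq (ratfun R) :=
  if n is m.+1 then
    let ps := [seq (g, h) | g <- reachable M m, h <- reachable M m] in
    let ops o := [seq farith o p.1 p.2 | p <- ps] in
    reachable M m ++ ops OpAdd ++ ops OpSub ++ ops OpMul ++ ops OpDiv
  else [:: fconst 0, fconst 1, ('X, 1) & map (@fconst R) (parameters M)].

Definition constant_ratfun (R : realType) (g : ratfun R) := exists c, g.1 = c *: g.2.

(** The consequence of transcendence over the parameters that controls a run, phrased so that it
    amounts to countably many conditions on [y]. *)
Definition generic (R : realType) (M : program R) (y : R) :=
  forall n g, g \in reachable M n -> g.2.[y] != 0 ->
    algebraicOver ratr (feval g y) -> constant_ratfun g.

(** [q] has finitely many roots a, and a nonconstant g takes the value a only at roots of the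
    nonzero polynomial [g.1 - a *: g.2]. *)
Lemma almost_all_transcendental (R : realType) (g : ratfun R) (q : {poly rat}) :
  q != 0 -> ~ constant_ratfun g ->
  almost_all (fun y => g.2.[y] != 0 -> ~~ root (map_poly ratr q) (feval g y)).
Proof.
move=> q0 nc; have qR0 : map_poly ratr q != 0 :> {poly R} by rewrite map_poly_eq0.
have [X XP] := almost_all_nonroot qR0.
have : almost_all (fun y => forall a, a \in X -> (g.1 - a *: g.2).[y] != 0).
  apply: almost_all_seq => a _; apply: almost_all_nonroot.
  by apply/negP; rewrite subr_eq0 => /eqP ga; apply: nc; exists a.
apply: almost_allW => y Hy gy; apply: XP; apply/negP => /Hy.
by rewrite hornerD hornerN hornerZ /feval divfK // subrr eqxx.
Qed.

Lemma exists_generic (R : realType) (M : program R) : exists y, generic M y.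
Proof.
(* One condition for each step, position in the list and rational polynomial: countably many, each
   failing at finitely many points. *)
pose P (k : nat * nat * {poly rat}) (y : R) :=
  let g := nth (fconst 0) (reachable M k.1.1) k.1.2 in
  ~ constant_ratfun g -> k.2 != 0 -> g.2.[y] != 0 ->
  ~~ root (map_poly ratr k.2) (feval g y).
have [|y yP] := @almost_all_countable R _ P.
  move=> [[n i] q]; rewrite /P /=; set g := nth _ _ _.
  have [cg|ncg] := pselect (constant_ratfun g); first exact: almost_allT.
  have [->|q0] := eqVneq q 0; first exact: almost_allT.
  by apply: almost_allW (almost_all_transcendental q0 ncg) => y Hy _ _.
exists y => n g gn gy [q q0 qg]; apply: contrapT => ncg.
have := yP (n, index g (reachable M n), q).
by rewrite /P /= nth_index // qg => /(_ ncg q0 gy).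
Qed.

Lemma reachableS (R : realType) (M : program R) n g :
  g \in reachable M n -> g \in reachable M n.+1.
Proof. by rewrite /= mem_cat => ->. Qed.

Lemma reachable_arith (R : realType) (M : program R) n o g h :
  g \in reachable M n -> h \in reachable M n -> farith o g h \in reachable M n.+1.
Proof.
move=> gn hn; have ghP : (g, h) \in [seq (g, h) | g <- reachable M n, h <- reachable M n].
  exact: allpairs_f.
have := map_f (fun p => farith o p.1 p.2) ghP.
by rewrite /= !mem_cat; case: o => /= ->; rewrite ?orbT.
Qed.

Lemma reachable_base (R : realType) (M : program R) n g :
  g \in [:: fconst 0, fconst 1, ('X, 1) & map (@fconst R) (parameters M)] ->
  g \in reachable M n.
Proof. by elim: n => // n IHn g0; apply/reachableS/IHn. Qed.

Lemma parametersP (R : realType) (M : program R) l i c :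
  onth M l = Some (Const i c) -> c \in parameters M.
Proof.
elim: M l => [|ins M IHM] [|l] //= => [[->]|/IHM cM]; first by rewrite inE eqxx.
by case: ins => //= *; rewrite inE cM orbT.
Qed.

Lemma feval_continuous (R : realType) (g : ratfun R) (y : R) : g.2.[y] != 0 ->
  feval g x @[x --> y] --> feval g y.
Proof.
by move=> gy; apply: cvgM; [|apply: cvgV => //]; exact: continuous_horner.
Qed.

Lemma near_horner_neq0 (R : realType) (p : {poly R}) (y : R) : p.[y] != 0 ->
  \forall x \near y, p.[x] != 0.
Proof.
move=> py; have pc : p.[x] @[x --> y] --> p.[y] by exact: continuous_horner.
exact: cvgr_neq0 pc py.
Qed.

Lemma near_constant (R : realType) (g : ratfun R) (y : R) :
  g.2.[y] != 0 -> constant_ratfun g -> \forall x \near y, feval g x = feval g y.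
Proof.
move=> gy [c gc]; apply: filterS (near_horner_neq0 gy) => x gx.
by rewrite /feval gc !hornerZ !mulfK.
Qed.

(** This keeps an oracle query with an invalid length cell undefined near [y]: a value that is
    negative or strictly between k and k+1 stays so. *)
Lemma near_non_nat (R : realType) (g : ratfun R) (y : R) : g.2.[y] != 0 ->
  feval g y \isn't a Num.nat -> \forall x \near y, feval g x \isn't a Num.nat.
Proof.
move=> gy nat_y; have cg := feval_continuous gy.
have [y0|y0] := ltP (feval g y) 0.
  apply: filterS (cvgr_lt _ cg _ y0) => x; rewrite ltNge.
  by apply: contra => /natrP[n ->]; rewrite ler0n.
have /andP[le lt] := truncn_itv y0.
set k := Num.truncn _ in le lt.
have {}le : k%:R < feval g y.
  by rewrite lt_neqAle le andbT -natrEtruncn.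
near=> x; apply/natrP => -[n xn].
have xk : k%:R < feval g x by near: x; exact: cvgr_gt cg _ le.
have xk1 : feval g x < k.+1%:R by near: x; exact: cvgr_lt cg _ lt.
by move: xk xk1; rewrite xn !ltr_nat ltnS => /leq_trans/[apply]; rewrite ltnn.
Unshelve. all: by end_near. Qed.

Lemma feval_farith (R : realType) o (g h : ratfun R) x :
  g.2.[x] != 0 -> h.2.[x] != 0 -> (o = OpDiv -> h.1.[x] != 0) ->
  arith_eval o (feval g x) (feval h x) = Some (feval (farith o g h) x).
Proof.
move=> gx hx ox; case: o ox => /= ox; rewrite /feval /= ?(hornerD, hornerN, hornerM).
- by congr Some; field; rewrite gx hx.
- by congr Some; field; rewrite gx hx.
- by congr Some; field; rewrite gx hx.
have {}ox := ox erefl.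
rewrite mulf_eq0 invr_eq0 (negPf ox) (negPf hx) /=.
by congr Some; field; rewrite gx hx ox.
Qed.

(** Induction on [n]. [T] describes the cells, and [G] collects the nonconstant functions put to the
    oracle: while their values at x are rejected, the run on x keeps to one path. At [y] they are
    rejected, being transcendental. *)
Lemma run_near_generic (R : realType) (B : set (seq R)) (M : program R) (y : R) n :
  (forall x, B x -> exists2 a, x = [:: a] & algebraicOver ratr a) -> generic M y ->
  exists l (T : int -> ratfun R) (G : seq (ratfun R)),
  [/\ forall i, T i \in reachable M n /\ (T i).2.[y] != 0,
      forall g, g \in G -> [/\ g.2.[y] != 0, ~ constant_ratfun g &
                              ~ algebraicOver ratr (feval g y)] &
      \forall x \near y, (forall g, g \in G -> ~ B [:: feval g x]) ->
        run B M [:: x] n = Config l (fun i => feval (T i) x)].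
Proof.
move=> BP geny; elim: n => [|n [l [T [G [TP GP nearT]]]]].
  exists 0%N, (fun i => match i with Posz 0 => fconst 1 | Posz 1 => ('X, 1) | _ => fconst 0 end), [::].
  split=> //.
    by move=> [[|[|i]]|i] /=; rewrite !inE eqxx ?orbT hornerC oner_neq0.
  near=> x => _; rewrite /run /=; congr Config; apply/funext => -[[|[|i]]|i] /=.
  - by rewrite fevalC.
  - by rewrite /feval /= hornerX hornerC divr1.
  - by rewrite nth_nil fevalC.
  - by rewrite fevalC.
have TPS i : T i \in reachable M n.+1 /\ (T i).2.[y] != 0.
  by have [/reachableS ? ?] := TP i.
suff [l' [T' [G' [TP' GP' near']]]] : exists l' (T' : int -> ratfun R) (G' : seq (ratfun R)),
  [/\ forall i, T' i \in reachable M n.+1 /\ (T' i).2.[y] != 0,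
      forall g, g \in G' -> [/\ g.2.[y] != 0, ~ constant_ratfun g &
                              ~ algebraicOver ratr (feval g y)] &
      \forall x \near y, (forall g, g \in G' -> ~ B [:: feval g x]) ->
        step B M (Config l (fun i => feval (T i) x)) =
        Config l' (fun i => feval (T' i) x)].
  exists l', T', (G' ++ G); split=> //.
    by move=> g; rewrite mem_cat => /orP[/GP'|/GP].
  apply: filterS2 nearT near' => x HT HT' HG.
  rewrite /run iterS -/(run B M [:: x] n) HT => [|g gG]; last by apply: HG; rewrite mem_cat gG orbT.
  by apply: HT' => g gG; apply: HG; rewrite mem_cat gG.
have setP (i : int) (g : ratfun R) : g \in reachable M n.+1 -> g.2.[y] != 0 ->
  forall j, [eta T with i |-> g] j \in reachable M n.+1 /\ ([eta T with i |-> g] j).2.[y] != 0.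
  by move=> gn gy j /=; case: eqP.
have setE (i : int) (g : ratfun R) x :
  (fun j => feval ([eta T with i |-> g] j) x) = [eta (fun j => feval (T j) x) with i |-> feval g x].
  by apply/funext => j /=; case: eqP.
rewrite /step /=; case Eins: (onth M l) => [ins|]; last first.
  by exists l, T, [::]; split=> //; apply: filterE.
have stuck : (\forall x \near y, exec B ins (Config l (fun i => feval (T i) x)) =
    Config l (fun i => feval (T i) x)) -> exists l' (T' : int -> ratfun R) (G' : seq (ratfun R)),
  [/\ forall i, T' i \in reachable M n.+1 /\ (T' i).2.[y] != 0,
      forall g, g \in G' -> [/\ g.2.[y] != 0, ~ constant_ratfun g &
                              ~ algebraicOver ratr (feval g y)] &
      \forall x \near y, (forall g, g \in G' -> ~ B [:: feval g x]) ->
        exec B ins (Config l (fun i => feval (T i) x)) =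
        Config l' (fun i => feval (T' i) x)].
  by move=> h; exists l, T, [::]; split=> //; apply: filterS h.
(* By genericity a function with an algebraic value at [y] is constant; this settles zero tests,
   vanishing divisors and length cells. *)
have alg_const i : algebraicOver ratr (feval (T i) y) ->
    \forall x \near y, feval (T i) x = feval (T i) y.
  by have [Tn Ty] := TP i; move=> /(geny _ _ Tn Ty)/(near_constant Ty).
case: ins Eins stuck => [i c|i|i j|o i j k|||i lneg lzero lpos|i lyes lno] Eins stuck.
- exists l.+1, [eta T with i |-> fconst c], [::]; split=> //.
    apply: setP; rewrite ?hornerC ?oner_neq0 // reachable_base // !inE map_f ?orbT //.
    exact: parametersP Eins.
  by apply: filterE => x _ /=; rewrite setE fevalC.
- exists l.+1, [eta T with i |-> fconst 0], [::]; split=> //.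
    by apply: setP; rewrite ?hornerC ?oner_neq0 // reachable_base // !inE eqxx.
  by apply: filterE => x _ /=; rewrite setE fevalC.
- exists l.+1, [eta T with i |-> T j], [::]; split=> //.
    by apply: setP; have [] := TPS j.
  by apply: filterE => x _ /=; rewrite setE.
- have [Tj Tjy] := TP j; have [Tk Tky] := TP k.
  have nj := near_horner_neq0 Tjy; have nk := near_horner_neq0 Tky.
  (* A divisor that vanishes at [y] vanishes nearby as well, so the machine hangs there too. *)
  have [[oD Tk0]|ndiv] := pselect (o = OpDiv /\ (T k).1.[y] = 0).
    apply: stuck; have v0 : feval (T k) y = 0 by rewrite /feval Tk0 mul0r.
    have := alg_const k; rewrite v0 => /(_ (algebraic0 _)).
    by apply: filterS => x /= ->; rewrite oD /= eqxx.
  have ky : o = OpDiv -> (T k).1.[y] != 0.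
    by move=> oD; apply/negP => /eqP ky; apply: ndiv.
  have nk1 : \forall x \near y, o = OpDiv -> (T k).1.[x] != 0.
    have [oD|noD] := pselect (o = OpDiv); last by apply: filterE => x /noD.
    by apply: filterS (near_horner_neq0 (ky oD)) => x.
  exists l.+1, [eta T with i |-> farith o (T j) (T k)], [::]; split=> //.
    apply: setP; first exact: reachable_arith.
    by case: (o) ky => /= ky; rewrite hornerM mulf_neq0 // ky.
  apply: filterS3 nj nk nk1 => x xj xk xk1 _ /=.
  by rewrite feval_farith // setE.
- exists l.+1, (fun i => T (-1 + i)), [::]; split=> //.
  by apply: filterE.
- exists l.+1, (fun i => T (1 + i)), [::]; split=> //.
  by apply: filterE.
- have [Ti Tiy] := TP i; have ci := feval_continuous Tiy.
  exists (if feval (T i) y < 0 then lneg else if feval (T i) y == 0 then lzero else lpos), T, [::].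
  split=> //; case: (ltgtP (feval (T i) y) 0) => [v0|v0|v0] /=.
  + by apply: filterS (cvgr_lt _ ci _ v0) => x /= ->.
  + by apply: filterS (cvgr_gt _ ci _ v0) => x /= v _; rewrite ltNge ltW //= gt_eqF.
  + have := alg_const i; rewrite v0 => /(_ (algebraic0 _)).
    by apply: filterS => x /= -> _; rewrite ltxx eqxx.
have [Ti Tiy] := TP i.
have [/natrP[k vk]|nnat] := boolP (feval (T i) y \is a Num.nat); last first.
  apply: stuck; apply: filterS (near_non_nat Tiy nnat) => x /= /negPf nx.
  by rewrite /decode /shift addr0 nx.
have ni : \forall x \near y, feval (T i) x = k%:R.
  by rewrite -vk; apply: alg_const; rewrite vk -(ratr_nat R); exact: algebraic_id.
have dec x : feval (T i) x = k%:R -> decode (shift i (fun i => feval (T i) x)) =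
    Some (mkseq (fun j => feval (T (i + j.+1%:Z)) x) k).
  by move=> vx; rewrite /decode {1 3}/shift addr0 vx natr_nat natrK.
(* All elements of [B] have length one, so a query of any other length is answered no. *)
have [k1|k1] := eqVneq k 1%N; last first.
  exists lno, T, [::]; split=> //; apply: filterS ni => x vx _ /=.
  rewrite dec //; case: asboolP => // /BP[a ka].
  by have := congr1 size ka; rewrite size_mkseq => /eqP; rewrite (negPf k1).
rewrite {}k1 in vk ni dec.
have [Th Thy] := TP (i + 1%:Z); set h := T (i + 1) in Th Thy.
have dec1 x : feval (T i) x = 1 ->
    decode (shift i (fun i => feval (T i) x)) = Some [:: feval h x] by exact: dec.
(* A constant query has the same answer near [y]; a nonconstant one joins [G], and its answer is no
   whenever its value is rejected. *)
have [ch|nch] := pselect (constant_ratfun h).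
  exists (if `[< B [:: feval h y] >] then lyes else lno), T, [::]; split=> //.
  apply: filterS2 ni (near_constant Thy ch) => x vx hx _ /=.
  by rewrite dec1 // hx.
exists lno, T, [:: h]; split=> //.
  by move=> g; rewrite inE => /eqP->; split=> // /(geny _ _ Th Thy).
apply: filterS ni => x vx Bx /=; rewrite dec1 //.
by case: asboolP => // /Bx; rewrite inE eqxx => /(_ isT).
Unshelve. all: by end_near. Qed.

(** * Refuting a reduction at a nearby point of degree p *)

Lemma algebraic_eq_algebraic (R : realType) d (x : R) :
  algebraic_eq d x -> algebraicOver ratr x.
Proof. by move=> [p [/monic_neq0 p0 _ px] _]; exists p. Qed.

Lemma halted_iter (R : realType) (B : set (seq R)) (M : program R) c n :
  halted M c -> iter n (step B M) c = c.
Proof.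
move=> Hc; elim: n => //= n ->; rewrite /step.
by rewrite onth_default.
Qed.

Lemma halted_run_unique (R : realType) (B : set (seq R)) (M : program R) x m n :
  halted M (run B M x m) -> halted M (run B M x n) -> run B M x m = run B M x n.
Proof.
wlog mn : m n / (m <= n)%N => [W hm hn|hm _].
  by have [/W/(_ hm hn)->|/ltnW/W/(_ hn hm)->] := leqP m n.
by rewrite -(subnK mn) [in RHS]/run iterD -/(run B M x m) halted_iter.
Qed.

Lemma generic_transcendental (R : realType) (M : program R) y :
  generic M y -> ~ algebraicOver ratr y.
Proof.
move=> geny algy; case: (geny 0%N ('X, 1)) => [|||c /= /(congr1 (size \o @polyseq R))].
- by rewrite !inE eqxx !orbT.
- by rewrite hornerC oner_neq0.
- by rewrite /feval hornerX hornerC divr1.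
by rewrite /= size_polyX alg_polyC size_polyC; case: eqP.
Qed.

Lemma decode_singleton (R : realType) (t : tape R) a :
  decode t = Some [:: a] <-> t 0 = 1 /\ t 1 = a.
Proof.
rewrite /decode; split=> [|[-> <-]]; last first.
  by rewrite rpred1 truncn1.
case: ifP => // /truncnK tK [seqE].
have k1 : Num.truncn (t 0) = 1%N by have := congr1 size seqE; rewrite size_mkseq.
by move: seqE tK; rewrite k1 => -[<-] <-.
Qed.

(** The transcendental [y] must be rejected. Its output cells hold 1 and 0, algebraic values, hence
    are locally constant. A nearby x of degree p whose queries in [G] are all negative is therefore
    rejected too, although it belongs to A_S. *)
Lemma not_bss_le_degree (R : realType) (S T : set nat) p :
  prime p -> T `<=` [set p | prime p] -> S p -> ~ T p ->
  ~ bss_le (@algebraic_in R S) (@algebraic_in R T).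
Proof.
move=> pp Tpr Sp nTp [M HM]; have [y geny] := exists_generic M.
have ntr := generic_transcendental geny.
have [n [hy]] := HM [:: y]; rewrite /char_fun asboolF; last first.
  by move=> [a [d _ /algebraic_eq_algebraic alga] [ay]]; rewrite ay in alga.
have BP x : algebraic_in T x -> exists2 a : R, x = [:: a] & algebraicOver ratr a.
  by move=> [a [d _ /algebraic_eq_algebraic ?] <-]; exists a.
have [l [F [G [FP GP nearF]]]] := @run_near_generic R _ M y n BP geny.
have GT (x : R) : ~ algebraicOver ratr x -> ~ algebraic_in T [:: x].
  by move=> nx /BP[a [<-]].
have runy := nbhs_singleton nearF.
have {}runy : run (algebraic_in T) M [:: y] n = Config l (fun i => feval (F i) y).
  by apply: runy => g /GP[_ _ /GT].
rewrite runy in hy * => /decode_singleton[/= F0y F1y].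
have nearE i q : feval (F i) y = ratr q -> \forall x \near y, feval (F i) x = ratr q.
  move=> Fq; have [Fi Fiy] := FP i; rewrite -Fq; apply: (near_constant Fiy).
  by apply: geny Fi Fiy _; rewrite Fq; exact: algebraic_id.
have := nearE 0 1; rewrite rmorph1 => /(_ F0y) near0.
have := nearE 1 0; rewrite rmorph0 => /(_ F1y) near1.
have [e /= e0 ball_e] := (nbhs_ballP _ _).1 (filterI nearF (filterI near0 near1)).
have [||x [ax xb degx Gx]] := @dense_avoid_degree R p G (y - e) (y + e) pp.
- by rewrite ltrD2l gtrN.
- move=> g /GP[gy gc _]; split=> //.
  by apply: contraNneq gy => ->; rewrite horner0.
have [|runx [x0 x1]] := ball_e x.
  by rewrite /ball /= distrC ltr_distl ax.
have {}runx : run (algebraic_in T) M [:: x] n = Config l (fun i => feval (F i) x).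
  (* A positive answer would give g(x) a prime degree q in T, and q differs from p because p is not
     in T. *)
  apply: runx => g gG [a [q Tq aq] [ag]]; apply: (Gx g gG q) => //.
  - exact: Tpr.
  - by apply/eqP => qp; apply: nTp; rewrite -qp.
  - by rewrite -/(feval g x) -ag.
have hx : halted M (run (algebraic_in T) M [:: x] n) by rewrite runx.
have [n' [hx' dx']] := HM [:: x].
move: dx'; rewrite -(halted_run_unique hx hx') runx /char_fun asboolT; last first.
  by exists x => //; exists p.
move=> /decode_singleton[_ /=]; rewrite x1 => /eqP.
by rewrite eq_sym oner_eq0.
Qed.

(** * A machine reading commands from the digits of a parameter *)

Variant command := CMul | CInc | CDec | CTest of bool.

Definition code (d : command) : nat :=
  match d with CMul => 0 | CInc => 1 | CDec => 2 | CTest b => 3 + b end.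

Definition act (R : realType) (y a : R) (d : command) : R :=
  match d with CMul => a * y | CInc => a + 1 | CDec => a - 1 | CTest _ => a end.

Definition is_test (d : command) := if d is CTest _ then true else false.

(** The base-6 expansion 0.d1 d2 ... with digits [code d], continued by the tail [u]. *)
Definition enc (R : realType) (ds : seq command) (u : R) : R :=
  foldr (fun d v => ((code d)%:R + v) / 6) u ds.

Lemma enc_cat (R : realType) ds es (u : R) : enc (ds ++ es) u = enc ds (enc es u).
Proof. exact: foldr_cat. Qed.

Lemma code_le4 d : (code d <= 4)%N.
Proof. by case: d => // -[]. Qed.

(** The largest digit preserves the interval: (4 + 5/6) / 6 < 5/6. *)
Lemma enc_itv (R : realType) ds (u : R) : 0 <= u <= 5 / 6 -> 0 <= enc ds u <= 5 / 6.
Proof.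
move=> u01; elim: ds => //= d ds /andP[v0 v1].
have d0 : 0 <= (code d)%:R :> R by rewrite ler0n.
have d4 : (code d)%:R <= 4 :> R by rewrite ler_nat code_le4.
by apply/andP; split; lra.
Qed.

Lemma enc_le (R : realType) ds (u v : R) : u <= v -> enc ds u <= enc ds v.
Proof. by move=> uv; elim: ds => //= d ds IHds; rewrite ler_pM2r // lerD2l. Qed.

Lemma cvg_enc (R : realType) ds (u : nat -> R) (l : R) :
  u n @[n --> \oo] --> l -> enc ds (u n) @[n --> \oo] --> enc ds l.
Proof.
move=> ul; elim: ds => //= d ds IHds.
by apply: cvgM; [apply: cvgD => //; exact: cvg_cst|exact: cvg_cst].
Qed.

(* Digits are at most 4, so tails stay below 5/6 < 1 and can be told apart from
   a leading digit by repeated subtraction of 1. *)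
Lemma exists_enc_stream (R : realType) (block : nat -> seq command) :
  exists tau : nat -> R, forall k,
    0 <= tau k <= 5 / 6 /\ tau k = enc (block k) (tau k.+1).
Proof.
(* [E k n] encodes [n] blocks from block [k] on, with tail 0. It is bounded and nondecreasing in
   [n]; its limit is [tau k], and continuity of [enc] gives the recursion. *)
pose fix E k n : R := if n is m.+1 then enc (block k) (E k.+1 m) else 0.
have E01 n : forall k, 0 <= E k n <= 5 / 6.
  elim: n => [|n IHn] k; last exact/enc_itv/IHn.
  by rewrite /= lexx divr_ge0.
have Emono k : nondecreasing_seq (E k).
  apply/nondecreasing_seqP => n; elim: n k => [|n IHn] k; last exact/enc_le/IHn.
  by have /andP[] := E01 1%N k.
have Ecvg k : cvgn (E k).
  apply: nondecreasing_is_cvgn => //; exists (5 / 6) => _ [n _ <-].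
  by have /andP[] := E01 n k.
exists (fun k => limn (E k)) => k; split.
  rewrite limr_ge ?limr_le //; apply: nearW => n; by have /andP[] := E01 n k.
have h1 : E k n.+1 @[n --> \oo] --> limn (E k) by rewrite cvg_shiftS; exact: Ecvg.
have h2 : E k n.+1 @[n --> \oo] --> enc (block k) (limn (E k.+1)).
  by apply: cvg_enc; exact: Ecvg.
exact: cvg_unique _ h1 h2.
Qed.

Definition add_commands (z : int) : seq command :=
  match z with Posz n => nseq n CInc | Negz n => nseq n.+1 CDec end.

Fixpoint horner_commands (s : seq int) : seq command :=
  if s is z :: s' then horner_commands s' ++ CMul :: add_commands z else [::].

Lemma horner_commands_no_test s : all (predC is_test) (horner_commands s).
Proof.
elim: s => //= z s IHs; rewrite all_cat IHs /=.
by case: z => n /=; rewrite ?all_nseq /= ?orbT.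
Qed.

Lemma act_add_commands (R : realType) (y a : R) z :
  foldl (act y) a (add_commands z) = a + z%:~R.
Proof.
case: z => n; rewrite ?NegzE ?rmorphN /= -!pmulrn.
  elim: n a => [|n IHn] a; first by rewrite mulr0n addr0.
  by rewrite [LHS]IHn -addrA -natr1 [1 + _]addrC.
elim: n a => [|n IHn] a //.
by rewrite [LHS]IHn -[in RHS]natr1; ring.
Qed.

Lemma act_horner_commands (R : realType) (y : R) s :
  foldl (act y) 0 (horner_commands s) = horner_rec (map intr s) y.
Proof. by elim: s => //= z s IHs; rewrite foldl_cat IHs /= act_add_commands. Qed.

Definition reaches (R : realType) (B : set (seq R)) (M : program R) (c c' : config R) :=
  exists n, iter n (step B M) c = c'.

Lemma reaches_refl (R : realType) (B : set (seq R)) (M : program R) c : reaches B M c c.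
Proof. by exists 0%N. Qed.

Lemma reaches_trans (R : realType) (B : set (seq R)) (M : program R) c1 c2 c3 :
  reaches B M c1 c2 -> reaches B M c2 c3 -> reaches B M c1 c3.
Proof. by move=> [m <-] [n <-]; exists (n + m)%N; rewrite iterD. Qed.

Lemma reaches_exec (R : realType) (B : set (seq R)) (M : program R) l t ins c :
  onth M l = Some ins -> reaches B M (exec B ins (Config l t)) c ->
  reaches B M (Config l t) c.
Proof. by move=> Eins [n <-]; exists n.+1; rewrite iterSr /step /= Eins. Qed.

(** The working cells are listed explicitly so that concrete steps are computed by rewriting. *)
Definition tape5 (R : realType) (r : tape R) (v0 v1 v2 v3 v4 : R) : tape R :=
  fun i => match i with
           | Posz 0 => v0 | Posz 1 => v1 | Posz 2 => v2 | Posz 3 => v3 | Posz 4 => v4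
           | _ => r i
           end.

Lemma tape5_eta (R : realType) (t : tape R) : t = tape5 t (t 0) (t 1) (t 2) (t 3) (t 4).
Proof. by apply/funext => -[[|[|[|[|[|n]]]]]|n]. Qed.

Lemma tape5_set (R : realType) (r : tape R) v0 v1 v2 v3 v4 a :
  ([eta tape5 r v0 v1 v2 v3 v4 with 0 |-> a] = tape5 r a v1 v2 v3 v4 :> tape R) *
  ([eta tape5 r v0 v1 v2 v3 v4 with 1 |-> a] = tape5 r v0 a v2 v3 v4 :> tape R) *
  ([eta tape5 r v0 v1 v2 v3 v4 with 2 |-> a] = tape5 r v0 v1 a v3 v4 :> tape R) *
  ([eta tape5 r v0 v1 v2 v3 v4 with 3 |-> a] = tape5 r v0 v1 v2 a v4 :> tape R) *
  ([eta tape5 r v0 v1 v2 v3 v4 with 4 |-> a] = tape5 r v0 v1 v2 v3 a :> tape R).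
Proof. by do !split; apply/funext => -[[|[|[|[|[|n]]]]]|n]. Qed.

(* Cell 0 holds 1, cell 1 the input, cell 2 the accumulator, cell 3 the remaining
   digits and cell 4 the base 6; the numbers below are jump targets. *)
Definition machine (R : realType) (c : R) : program R :=
  [:: BranchOracle 0 1 29;
      Const 3 c;
      Zero 2;
      Const 4 6;
      (* 4: read a digit *)
      Arith OpMul 3 3 4;
      Arith OpSub 3 3 0;
      BranchSign 3 16 7 7;
      Arith OpSub 3 3 0;
      BranchSign 3 19 9 9;
      Arith OpSub 3 3 0;
      BranchSign 3 22 11 11;
      Arith OpSub 3 3 0;
      BranchSign 3 25 13 13;
      BranchSign 2 14 27 14;
      Zero 2;
      BranchSign 4 4 4 4;
      (* 16: CMul *)
      Arith OpAdd 3 3 0; Arith OpMul 2 2 1; BranchSign 4 4 4 4;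
      (* 19: CInc *)
      Arith OpAdd 3 3 0; Arith OpAdd 2 2 0; BranchSign 4 4 4 4;
      (* 22: CDec *)
      Arith OpAdd 3 3 0; Arith OpSub 2 2 0; BranchSign 4 4 4 4;
      (* 25: CTest false *)
      Arith OpAdd 3 3 0; BranchSign 2 14 29 14;
      (* 27: answer 1 *)
      Copy 1 0; BranchSign 4 31 31 31;
      (* 29: answer 0 *)
      Zero 1; Const 0 1].

Ltac mstep := apply: reaches_exec; [reflexivity | rewrite /= ?tape5_set].

Section Machine.
Variables (R : realType) (B : set (seq R)) (c : R).
Local Notation M := (machine c).
Local Notation state r y a u := (Config 4 (tape5 r 1 y a u 6)).

(** Multiplication by 6 exposes digit plus tail. Ones are subtracted until the result is negative,
    which identifies the digit as [u] < 1; adding 1 back leaves the tail [u]. *)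
Lemma machine_command r (y a u : R) d : ~~ is_test d -> 0 <= u <= 5 / 6 ->
  reaches B M (state r y a (((code d)%:R + u) / 6)) (state r y (act y a d) u).
Proof.
move=> nt /andP[u0 u1].
have neg : u - 1 < 0 by lra.
have tailE k : (k%:R + u) / 6 * 6 = k%:R + u by rewrite divfK.
have nonneg (v : R) (i j : nat) : 0 <= v -> (if v < 0 then i else if v == 0 then j else j) = j.
  by move=> v0; rewrite ltNge v0 if_same.
mstep; rewrite tailE; mstep.
case: d nt => //= _; rewrite ?add0r.
- mstep; rewrite neg; mstep; rewrite subrK; mstep; mstep; rewrite !if_same.
  exact: reaches_refl.
- rewrite (_ : 1 + u - 1 = u); last by ring.
  mstep; rewrite nonneg //; mstep; mstep; rewrite neg.
  by mstep; rewrite subrK; mstep; mstep; rewrite !if_same; exact: reaches_refl.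
rewrite (_ : 2 + u - 1 = u + 1); last by ring.
mstep; rewrite nonneg ?addr_ge0 //; mstep; rewrite addrK; mstep; rewrite nonneg //.
mstep; mstep; rewrite neg; mstep; rewrite subrK.
by mstep; mstep; rewrite !if_same; exact: reaches_refl.
Qed.

(** Three subtractions leave [u + b], and the sign after the fourth tells digit 3 from digit 4. A
    nonzero accumulator is reset for the next polynomial. *)
Lemma machine_test r (y a u : R) b : 0 <= u <= 5 / 6 ->
  reaches B M (state r y a (((code (CTest b))%:R + u) / 6))
    (if a == 0 then Config (if b then 27 else 29) (tape5 r 1 y a u 6)
     else state r y 0 u).
Proof.
move=> /andP[u0 u1].
have neg : u - 1 < 0 by lra.
have nonneg (v : R) (i j : nat) : 0 <= v -> (if v < 0 then i else if v == 0 then j else j) = j.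
  by move=> v0; rewrite ltNge v0 if_same.
have zero (i j : nat) : (if a < 0 then i else if a == 0 then j else i) = if a == 0 then j else i.
  by case: ltgtP.
mstep; rewrite divfK // natrD; mstep.
rewrite (_ : 3 + b%:R + u - 1 = u + 1 + 1 + b%:R); last by ring.
mstep; rewrite nonneg ?addr_ge0 //; mstep.
rewrite (_ : u + 1 + 1 + b%:R - 1 = u + 1 + b%:R); last by ring.
mstep; rewrite nonneg ?addr_ge0 //; mstep.
rewrite (_ : u + 1 + b%:R - 1 = u + b%:R); last by ring.
mstep; rewrite nonneg ?addr_ge0 //; mstep.
have reset : reaches B M (Config 14 (tape5 r 1 y a u 6)) (state r y 0 u).
  by mstep; mstep; rewrite !if_same; exact: reaches_refl.
case: b; rewrite ?addr0 ?addrK; mstep.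
  rewrite nonneg //; mstep; rewrite zero.
  by case: eqP => // _; exact: reaches_refl.
rewrite neg; mstep; rewrite subrK; mstep; rewrite zero.
by case: eqP => // _; exact: reaches_refl.
Qed.

Lemma machine_commands r (y a u : R) ds : all (predC is_test) ds -> 0 <= u <= 5 / 6 ->
  reaches B M (state r y a (enc ds u)) (state r y (foldl (act y) a ds) u).
Proof.
move=> + u01; elim: ds a => [|d ds IHds] a /=; first by move=> _; exact: reaches_refl.
move=> /andP[nt /IHds IH]; apply: reaches_trans (IH _).
exact/machine_command/enc_itv.
Qed.

Definition answers (c : config R) (b : R) := exists2 c', reaches B M c c' &
  halted M c' /\ decode (cells c') = Some [:: b].

Lemma answers_reaches c1 c2 b : reaches B M c1 c2 -> answers c2 b -> answers c1 b.
Proof. by move=> r12 [c3 r23 h]; exists c3 => //; exact: reaches_trans r23. Qed.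

Lemma machine_answer_yes r (y a u : R) : answers (Config 27 (tape5 r 1 y a u 6)) 1.
Proof.
exists (Config 31 (tape5 r 1 1 a u 6)); last by split=> //; exact/decode_singleton.
by mstep; mstep; rewrite !if_same; exact: reaches_refl.
Qed.

(** The tape is arbitrary because this location is also entered directly from the initial query, on
    inputs of any length. *)
Lemma machine_answer_no (t : tape R) : answers (Config 29 t) 0.
Proof.
exists (Config 31 (tape5 t 1 0 (t 2) (t 3) (t 4))); last by split=> //; exact/decode_singleton.
by rewrite [X in Config 29 X]tape5_eta; mstep; mstep; exact: reaches_refl.
Qed.

End Machine.

(** * Correctness of the machine and the reduction for S contained in T *)

Lemma decode_encode (R : realType) (x : seq R) : decode (shift 0 (encode x)) = Some x.
Proof.
rewrite /decode {1}/shift addr0 /= natr_nat /shift addr0 /= natrK.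
by congr Some; rewrite -[RHS](mkseq_nth 0); exact: eq_mkseq.
Qed.

Lemma irreducible_root_size (R : realType) (y : R) (p q : {poly rat}) :
  irreducible_poly p -> root (map_poly ratr p) y ->
  irreducible_poly q -> root (map_poly ratr q) y -> size p = size q.
Proof.
move=> irr_p py irr_q qy.
have p0 : p != 0 by rewrite -size_poly_gt0; case: irr_p => /ltnW.
have q0 : q != 0 by rewrite -size_poly_gt0; case: irr_q => /ltnW.
by apply/eqP; rewrite eqn_leq (subfx_irreducibleP py p0).2 // (subfx_irreducibleP qy q0).2.
Qed.

(** The commands add integers only, so denominators are cleared first; a nonzero scalar does not
    change the roots. *)
Lemma rat_poly_scale_root (R : realType) (p : {poly rat}) (y : R) :
  (horner_rec (map intr (projT1 (rat_poly_scale p))) y == 0) = root (map_poly ratr p) y.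
Proof.
case: rat_poly_scale => q /= [a a0 ->].
rewrite map_polyZ /= rootZ ?fmorph_eq0 ?invr_eq0 ?intr_eq0 //.
rewrite -map_poly_comp (eq_map_poly (g := intr)) => [|z /=]; last by rewrite ratr_int.
by rewrite -horner_Poly -map_polyE.
Qed.

(** Every irreducible rational polynomial vanishing at [y] has the degree of [y], so whichever is
    found first gives the right answer. *)
Lemma algebraic_in_irreducible (R : realType) (S : set nat) (y : R) (p q : {poly rat}) :
  is_min_poly y p -> irreducible_poly q -> root (map_poly ratr q) y ->
  algebraic_in S [:: y] <-> S (size q).-1.
Proof.
move=> py irr_q qy; have pq (p' : {poly rat}) : is_min_poly y p' -> size p' = size q.
  by case=> _ irr_p' p'y; exact: irreducible_root_size irr_p' p'y irr_q qy.
split=> [[z [d Sd [p' p'z sp']] [zy]]|Sq].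
  by rewrite zy in p'z; rewrite -(pq _ p'z) sp'.
exists y => //; exists (size q).-1 => //; exists p => //.
by rewrite (pq _ py) prednK //; case: irr_q => /ltnW.
Qed.

(** Block [k] treats the rational polynomial with code [k]. The answer is written into the block, so
    [S] may be any set: its membership is stored in the real parameter. *)
Definition poly_block (S : set nat) (k : nat) : seq command :=
  if unpickle k is Some p then
    if `[< irreducible_poly p >] then
      rcons (horner_commands (projT1 (rat_poly_scale p))) (CTest `[< S (size p).-1 >])
    else [::]
  else [::].

(** A negative answer of the oracle excludes A_S, as S is contained in T. After a positive one the
    input is some algebraic [y], and the scan of the blocks stops at the latest at the minimal
    polynomial of [y]. *)
Lemma bss_le_degree (R : realType) (S T : set nat) :
  S `<=` T -> bss_le (@algebraic_in R S) (@algebraic_in R T).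
Proof.
move=> ST; have [tau tauP] := exists_enc_stream R (poly_block S).
exists (machine (tau 0%N)) => x.
suff [c' [n run_n] halt] : answers (algebraic_in T) (tau 0%N) (init x)
    (if `[< algebraic_in S x >] then 1 else 0).
  by exists n; rewrite /run run_n.
have [Tx|nTx] := pselect (algebraic_in T x); last first.
  rewrite asboolF; last by move=> [a [d /ST Td ad] ax]; apply: nTx; exists a => //; exists d.
  apply: answers_reaches (machine_answer_no _ _ (encode x)).
  mstep; rewrite decode_encode (asboolF nTx); exact: reaches_refl.
have [y [d Td yd] yx] := Tx; rewrite -{}yx in Tx *.
have init_tape : encode [:: y] = tape5 (encode [:: y]) 1 y 0 0 0 by rewrite [LHS]tape5_eta.
set r := encode [:: y] in init_tape.
apply: (@answers_reaches _ _ _ _ (Config 4 (tape5 r 1 y 0 (tau 0%N) 6))).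
  rewrite /init; mstep; rewrite decode_encode (asboolT Tx) -/r [X in Config 1 X]init_tape.
  mstep; mstep; mstep; exact: reaches_refl.
have [p [mon_p irr_p py] _] := yd.
pose ans k := answers (algebraic_in T) (tau 0%N) (Config 4 (tape5 r 1 y 0 (tau k) 6))
  (if `[< algebraic_in S [:: y] >] then 1 else 0).
(* Either block [k] finds a root and answers correctly, or the machine goes on to block k+1; the
   latter cannot happen if block [k] treats [p]. *)
have block_step k : unpickle k = Some p \/ ans k.+1 -> ans k.
  rewrite /ans; have [_ ->] := tauP k; have [u01 _] := tauP k.+1.
  rewrite /poly_block; case: (unpickle k) => [q|]; last by case.
  case: (asboolP (irreducible_poly q)) => [irr_q|nirr]; last first.
    by case=> // -[qp]; case: nirr; rewrite qp.
  move=> alt; rewrite -cats1 enc_cat.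
  have u02 := @enc_itv _ [:: CTest `[< S (size q).-1 >]] _ u01.
  have runH := machine_commands (algebraic_in T) (tau 0%N) r y 0
    (horner_commands_no_test (projT1 (rat_poly_scale q))) u02.
  apply: answers_reaches runH _; rewrite act_horner_commands.
  apply: answers_reaches (machine_test _ _ _ _ _ _ u01) _.
  rewrite rat_poly_scale_root; case: ifPn => [qy|nqy]; last first.
    by case: alt => // -[qp]; case/negP: nqy; rewrite qp.
  have [p' pp'] : exists p', is_min_poly y p' by exists p.
  have SE := algebraic_in_irreducible S pp' irr_q qy.
  case: (asboolP (S _)) => Sq.
    by rewrite asboolT; [exact: machine_answer_yes|exact/SE].
  by rewrite asboolF; [exact: machine_answer_no|move=> /SE].
(* Induction on the distance [n] from block [k] to the block of [p]. *)
have scan n k : unpickle (k + n) = Some p -> ans k.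
  elim: n k => [|n IHn] k kp; apply: block_step; first by left; rewrite -kp addn0.
  by right; apply: IHn; rewrite addSnnS.
by apply: (scan (pickle p) 0%N); rewrite add0n pickleK.
Qed.

Theorem theorem5p4 (R : realType) (S T : set nat)
    (hS : S `<=` [set p | prime p]) (hT : T `<=` [set p | prime p]) :
  bss_le (@algebraic_in R S) (@algebraic_in R T) <-> S `<=` T.
Proof.
split=> [le_ST p Sp|]; last exact: bss_le_degree.
apply: contrapT => nTp; exact: not_bss_le_degree (hS _ Sp) hT Sp nTp le_ST.
Qed.
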